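(* Let $\operatorname{Spec}(A)$ be an affine $\mathbb{G}_a$-variety over $k$ with action $\beta$, and let $h \in A^{\mathbb{G}_a}$ be a non-zero invariant. The following statements are equivalent: (a) the variety $D(h)$ is a trivial $\mathbb{G}_a$-bundle over $D(h)//\mathbb{G}_a$; (b) there is a dominant, generically smooth, $\mathbb{G}_a$-equivariant morphism $\Phi: D(h) \to \mathbb{G}_a$ such that the fibres of $\Phi$ are connected; (c) there is a principle pair $(g,h^e)$ for some $g \in A$ and some $e \in \mathbb{N}_0$; (d) there exists a $g \in A$ such that, if $\pi: D(h) \to D(h)//\mathbb{G}_a$ is the quotient morphism and $\iota: \mathcal{V}(\langle g\rangle)\cap D(h) \to D(h)$ is the inclusion morphism, then the stabilizer of every point $x \in \mathcal{V}(\langle g\rangle) \cap D(h)$ is trivial and $\pi\circ\iota$ is an isomorphism.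
   Context: $k$ is an algebraically closed field and $\mathbb{G}_a=\operatorname{Spec}(k[t])$ is the additive group. Varieties are integral separated schemes of finite type over $k$. For an affine $\mathbb{G}_a$-variety $\operatorname{Spec}(A)$ with action $\beta$, the co-action is $\beta^\sharp: A\to A[t]$, and $A^{\mathbb{G}_a}=\{a\in A:\beta^\sharp(a)=a\}$. For $h\in A^{\mathbb{G}_a}$, $D(h)=\operatorname{Spec}(A_h)$ and $D(h)//\mathbb{G}_a=\operatorname{Spec}((A_h)^{\mathbb{G}_a})$. $D(h)$ is a trivial $\mathbb{G}_a$-bundle over $D(h)//\mathbb{G}_a$ if it is $\mathbb{G}_a$-equivariantly isomorphic, over $D(h)//\mathbb{G}_a$, to $\mathbb{G}_a\times(D(h)//\mathbb{G}_a)$ with $\mathbb{G}_a$ acting by translation on the first factor. In (b), $\mathbb{G}_a$ acts on itself by translation. A principle pair is a pair $(g,h)$ with $g\in A$, $h\in A^{\mathbb{G}_a}$ and $\beta^\sharp(g)=g+t\,h$ (equivalently $g(t_0\ast x)=g(x)+t_0h(x)$ for all points $t_0\in\mathbb{G}_a$, $x\in \operatorname{Spec}(A)$). $\mathcal{V}(I)$ denotes the closed subscheme defined by the ideal $I$. *)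

(* Defs.v *)
From HB Require Import structures.
From mathcomp Require Import all_boot all_order all_algebra.
From mathcomp Require Import boolp classical_sets.
From mathcomp Require Import topology_structure connected.
From mathcomp Require Import mpoly.

Set Implicit Arguments.
Unset Strict Implicit.
Unset Printing Implicit Defensive.

Import GRing.Theory.
Local Open Scope classical_set_scope.
Local Open Scope ring_scope.

(* All schemes that occur are affine.  A morphism Spec S -> Spec R is given by
   its ring morphism R -> S, and a k-algebra is a ring S with a ring morphism
   k -> S.  Membership in a [set S] is decidable by classical logic. *)

Section Spectrum.

Record spec (R : comNzRingType) := Spec {
  spec_set :> set R;
  spec_ideal : idealr_closed [pred a in spec_set];
  spec_prime : prime_idealr_closed [pred a in spec_set]
}.

Variable R : comNzRingType.

HB.instance Definition _ := gen_eqMixin (spec R).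
HB.instance Definition _ := gen_choiceMixin (spec R).

(* The Zariski closed sets are the V(I) for arbitrary subsets I of R. *)
Definition zariski_open (U : set (spec R)) :=
  exists I : set R, U = [set p | ~ (I `<=` spec_set p)].

Lemma spec_set1 (p : spec R) : ~ spec_set p 1.
Proof. by case: (spec_ideal p) => _ /negP p1 _ h; apply: p1; rewrite !inE. Qed.

Lemma spec_set0 (p : spec R) : spec_set p 0.
Proof. by case: (spec_ideal p); rewrite !inE. Qed.

Lemma spec_setMD (p : spec R) a x y :
  spec_set p x -> spec_set p y -> spec_set p (a * x + y).
Proof.
case: (spec_ideal p) => _ _ pM px py.
by have := pM a x y; rewrite !inE; apply.
Qed.

Lemma spec_setM (p : spec R) a x : spec_set p x -> spec_set p (a * x).
Proof. by move=> px; rewrite -[a * x]addr0; apply/spec_setMD/spec_set0. Qed.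

Lemma spec_set_prime (p : spec R) x y :
  spec_set p (x * y) -> spec_set p x \/ spec_set p y.
Proof.
by have := @spec_prime _ p x y; rewrite !inE => h /h /orP[]; rewrite !inE; [left|right].
Qed.

Lemma zariski_openT : zariski_open setT.
Proof.
exists setT; apply/esym; rewrite -subTset => p _ /(_ 1 I); exact: spec_set1.
Qed.

Lemma zariski_openI : setI_closed zariski_open.
Proof.
move=> _ _ [I ->] [J ->].
exists [set z | exists x y, [/\ I x, J y & z = x * y]].
apply/seteqP; split=> p /=.
  move=> [/existsNP [x /not_implyP[Ix px]] /existsNP [y /not_implyP[Jy py]]].
  move=> IJp; have : spec_set p (x * y) by apply: IJp; exists x, y.
  by move=> /spec_set_prime[].
move=> IJp; split=> h; apply: IJp => _ [x [y [Ix Jy ->]]].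
  by rewrite mulrC; apply/spec_setM/h.
exact/spec_setM/h.
Qed.

Lemma zariski_open_bigU (T : Type) (f : T -> set (spec R)) :
  (forall i, zariski_open (f i)) -> zariski_open (\bigcup_i f i).
Proof.
move=> /choice[I fI]; exists (\bigcup_i I i).
apply/seteqP; split=> p /=.
  by case=> i _; rewrite fI => nIp Ip; apply: nIp => x Ix; apply: Ip; exists i.
move=> nIp; apply: contrapT => np; apply: nIp => x [i _ Ix].
apply: contrapT => npx; apply: np; exists i => //; rewrite fI => /(_ _ Ix).
exact: npx.
Qed.

HB.instance Definition _ := isOpenTopological.Build (spec R)
  zariski_openT zariski_openI zariski_open_bigU.

End Spectrum.

Section Comap.
Variables (R S : comNzRingType) (f : {rmorphism R -> S}).

Lemma comap_ideal (p : spec S) : idealr_closed [pred a in f @^-1` spec_set p].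
Proof.
split; rewrite ?inE /= ?rmorph0 ?rmorph1; first exact: spec_set0.
  by apply/negP; rewrite inE /= rmorph1; exact: spec_set1.
by move=> a u v; rewrite !inE /= rmorphD rmorphM; exact: spec_setMD.
Qed.

Lemma comap_prime (p : spec S) : prime_idealr_closed [pred a in f @^-1` spec_set p].
Proof.
move=> u v; rewrite !inE /= rmorphM => /spec_set_prime[] h; apply/orP.
  by left; rewrite inE.
by right; rewrite inE.
Qed.

Definition comap (p : spec S) : spec R := Spec (comap_ideal p) (@comap_prime p).

Definition dominant := dense (range comap).

(* The fibre over r as a subspace of Spec S; it is canonically homeomorphic to
   the space underlying the scheme-theoretic fibre. *)
Definition fibre (r : spec R) : set (spec S) := comap @^-1` [set r].

End Comap.

(* The localization A_h, realized as the subring of those x in the fraction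
   field with h^n x in A for some n; this is A_h only if h != 0. *)
Section Localization.
Variables (A : idomainType) (h : A).

Definition in_loc : {pred {fraction A}} :=
  fun x => `[< exists a n, x * (tofrac h) ^+ n = tofrac a >].

Fact in_loc_subring : subring_closed in_loc.
Proof.
split.
- by apply/asboolP; exists 1, 0%N; rewrite expr0 mulr1 rmorph1.
- move=> x y /asboolP[a [n xa]] /asboolP[b [m yb]]; apply/asboolP.
  exists (a * h ^+ m - b * h ^+ n), (n + m)%N.
  rewrite rmorphB !rmorphM !rmorphXn /= -xa -yb mulrBl exprD mulrA; congr (_ - _).
  by rewrite -!mulrA [X in _ * X]mulrC.
- move=> x y /asboolP[a [n xa]] /asboolP[b [m yb]]; apply/asboolP.
  by exists (a * b), (n + m)%N; rewrite rmorphM /= -xa -yb exprD mulrACA.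
Qed.

HB.instance Definition _ := GRing.isSubringClosed.Build {fraction A} in_loc
  in_loc_subring.

Record loc := Loc { loc_val : {fraction A}; loc_valP : loc_val \in in_loc }.

HB.instance Definition _ := [isSub for loc_val].
HB.instance Definition _ := [Choice of loc by <:].
HB.instance Definition _ := [SubChoice_isSubComNzRing of loc by <:].

Definition loc_unit : pred loc := fun x => `[< exists y : loc, y * x = 1 >].
Definition loc_inv (x : loc) : loc :=
  if pselect (exists y : loc, y * x = 1) is left e then projT1 (cid e) else x.

Fact loc_mulVx : {in loc_unit, left_inverse 1 loc_inv *%R}.
Proof. by move=> x /asboolP ux; rewrite /loc_inv; case: pselect => // e; case: cid. Qed.

Fact loc_unitPl (x y : loc) : y * x = 1 -> loc_unit x.
Proof. by move=> yx; apply/asboolP; exists y. Qed.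

Fact loc_invr_out : {in [predC loc_unit], loc_inv =1 id}.
Proof. by move=> x /asboolPn nux; rewrite /loc_inv; case: pselect. Qed.

HB.instance Definition _ := GRing.ComNzRing_hasMulInverse.Build loc
  loc_mulVx loc_unitPl loc_invr_out.
HB.instance Definition _ :=
  [SubComUnitRing_isSubIntegralDomain of loc by <:].

Fact loc_inj_subproof (a : A) : tofrac a \in in_loc.
Proof. by apply/asboolP; exists a, 0%N; rewrite expr0 mulr1. Qed.

Definition loc_inj (a : A) : loc := Loc (loc_inj_subproof a).

Fact loc_inj_zmod_morphism : zmod_morphism loc_inj.
Proof. by move=> a b; apply: val_inj; rewrite /= rmorphB. Qed.
Fact loc_inj_monoid_morphism : monoid_morphism loc_inj.
Proof. by split=> [|a b]; apply: val_inj; rewrite /= ?rmorph1 ?rmorphM. Qed.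

HB.instance Definition _ := GRing.isZmodMorphism.Build A loc loc_inj
  loc_inj_zmod_morphism.
HB.instance Definition _ := GRing.isMonoidMorphism.Build A loc loc_inj
  loc_inj_monoid_morphism.

Lemma loc_inj_injective : injective loc_inj.
Proof. by move=> a b /(congr1 val)/= /eqP; rewrite tofrac_eq => /eqP. Qed.

Lemma loc_fracP (x : loc) : exists an : A * nat,
  x * loc_inj h ^+ an.2 = loc_inj an.1.
Proof.
case: x => x xP; have /asboolP[a [n xa]] := xP.
by exists (a, n); apply: val_inj; rewrite rmorphM rmorphXn /= xa.
Qed.

Hypothesis h0 : h != 0.

Fact loc_h_inv_subproof : (tofrac h)^-1 \in in_loc.
Proof.
by apply/asboolP; exists 1, 1%N; rewrite expr1 rmorph1 mulVf ?tofrac_eq0.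
Qed.

Definition loc_h_inv : loc := Loc loc_h_inv_subproof.

Lemma loc_h_invP : loc_inj h * loc_h_inv = 1.
Proof. by apply: val_inj; rewrite rmorphM rmorph1 /= mulfV ?tofrac_eq0. Qed.

End Localization.

(* The extension of f : A -> T to A_h -> T, where u is the inverse of f h. *)
Section Lift.
Variables (A : idomainType) (h : A) (T : comNzRingType).
Variables (f : {rmorphism A -> T}) (u : T) (fu : f h * u = 1).

Definition loc_lift of f h * u = 1 := fun x : loc h =>
  let an := projT1 (cid (loc_fracP x)) in f an.1 * u ^+ an.2.

Lemma loc_liftE (x : loc h) a n : x * loc_inj h h ^+ n = loc_inj h a ->
  loc_lift fu x = f a * u ^+ n.
Proof.
move=> xa; rewrite /loc_lift; case: cid => -[b m] /= xb.
have ab : b * h ^+ n = a * h ^+ m.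
  apply: (@loc_inj_injective A h).
  by rewrite !rmorphM !rmorphXn /= -xa -xb -!mulrA; congr (_ * _); exact: mulrC.
have hu i : f h ^+ i * u ^+ i = 1 by rewrite -exprMn fu expr1n.
rewrite -[f b]mulr1 -(hu n) mulrA -rmorphXn -rmorphM ab rmorphM rmorphXn.
by rewrite mulrAC -[X in X * _]mulrA hu mulr1.
Qed.

Fact loc_lift_zmod_morphism : zmod_morphism (loc_lift fu).
Proof.
move=> x y; have [[a n] /= xa] := loc_fracP x; have [[b m] /= yb] := loc_fracP y.
have hu i : f h ^+ i * u ^+ i = 1 by rewrite -exprMn fu expr1n.
rewrite (loc_liftE xa) (loc_liftE yb).
rewrite (@loc_liftE _ (a * h ^+ m - b * h ^+ n) (n + m)%N).
  rewrite rmorphB !rmorphM !rmorphXn mulrBl exprD; congr (_ - _).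
    by rewrite mulrACA hu mulr1.
  by rewrite -mulrA mulrA [u ^+ n * _]mulrC mulrACA hu mulr1.
rewrite rmorphB !rmorphM !rmorphXn /= -xa -yb mulrBl exprD mulrA; congr (_ - _).
by rewrite -!mulrA; congr (_ * _); exact: mulrC.
Qed.

Fact loc_lift_monoid_morphism : monoid_morphism (loc_lift fu).
Proof.
split.
  rewrite (@loc_liftE _ 1 0%N) ?expr0 ?mulr1 ?rmorph1 //.
move=> x y; have [[a n] /= xa] := loc_fracP x; have [[b m] /= yb] := loc_fracP y.
rewrite (loc_liftE xa) (loc_liftE yb) (@loc_liftE _ (a * b) (n + m)%N).
  by rewrite rmorphM exprD mulrACA.
by rewrite rmorphM /= -xa -yb exprD mulrACA.
Qed.

HB.instance Definition _ := GRing.isZmodMorphism.Build (loc h) T (loc_lift fu)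
  loc_lift_zmod_morphism.
HB.instance Definition _ := GRing.isMonoidMorphism.Build (loc h) T (loc_lift fu)
  loc_lift_monoid_morphism.

End Lift.

Definition finite_type (R S : comNzRingType) (f : {rmorphism R -> S}) :=
  exists n (x : 'I_n -> S),
    forall s, exists p : {mpoly R[n]}, mmap f x p = s.

Definition finite_presentation (R S : comNzRingType) (f : {rmorphism R -> S}) :=
  exists n (x : 'I_n -> S) m (r : 'I_m -> {mpoly R[n]}),
    (forall s, exists p : {mpoly R[n]}, mmap f x p = s) /\
    (forall p : {mpoly R[n]}, mmap f x p = 0 <->
       exists c : 'I_m -> {mpoly R[n]}, p = \sum_(i < m) c i * r i).

(* Infinitesimal lifting along all surjections pi : C -> D whose kernel has
   square zero. *)
Definition formally_smooth (R S : comNzRingType) (f : {rmorphism R -> S}) :=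
  forall (C D : comNzRingType) (pi : {rmorphism C -> D}),
    (forall d, exists c, pi c = d) ->
    (forall c c', pi c = 0 -> pi c' = 0 -> c * c' = 0) ->
  forall (r : {rmorphism R -> C}) (s : {rmorphism S -> D}),
    s \o f =1 pi \o r ->
  exists s' : {rmorphism S -> C}, pi \o s' =1 s /\ s' \o f =1 r.

Definition smooth (R S : comNzRingType) (f : {rmorphism R -> S}) :=
  finite_presentation f /\ formally_smooth f.

Definition smooth_at (R : comNzRingType) (S : idomainType)
    (f : {rmorphism R -> S}) (q : spec S) :=
  exists2 s, ~ spec_set q s & smooth (loc_inj s \o f).

Definition generically_smooth (R : comNzRingType) (S : idomainType)
    (f : {rmorphism R -> S}) :=
  exists U : set (spec S), [/\ open U, dense U & forall q, U q -> smooth_at f q].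

(* The co-action of G_a = Spec R[s] on itself by translation, s |-> s + t.  In
   {poly {poly R}} the inner variable is s and the outer variable is t. *)
Definition translation (R : comNzRingType) (p : {poly R}) : {poly {poly R}} :=
  p^:P \Po ('X + 'X%:P).

(* The last clause is (beta (x) id) o beta = (id (x) Delta) o beta; in
   {poly {poly A}} the tensor factors k[t] of Delta are the inner and the outer
   variable, and Delta sends t to their sum. *)
Definition is_coaction (k A : comNzRingType) (iota : {rmorphism k -> A})
    (beta : {rmorphism A -> {poly A}}) :=
  [/\ forall c, beta (iota c) = (iota c)%:P,
      forall a, (beta a).[0] = a &
      forall a, map_poly beta (beta a) = (beta a)^:P \Po ('X + 'X%:P)].

Definition equivariant (S T : comNzRingType) (sigma : S -> {poly S})
    (tau : T -> {poly T}) (f : {rmorphism S -> T}) :=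
  forall x, tau (f x) = map_poly f (sigma x).

Section Invariants.
Variables (S : comNzRingType) (sigma : {rmorphism S -> {poly S}}).

Definition Ga_invariant : {pred S} := fun a => sigma a == a%:P.

Fact invariant_subring : subring_closed Ga_invariant.
Proof.
split=> [|x y|x y]; rewrite !unfold_in.
- by rewrite rmorph1.
- by move=> /eqP hx /eqP hy; rewrite rmorphB hx hy polyCB.
- by move=> /eqP hx /eqP hy; rewrite rmorphM hx hy polyCM.
Qed.

HB.instance Definition _ := GRing.isSubringClosed.Build S Ga_invariant
  invariant_subring.

Record Ga_invariants :=
  Invariants { inv_val : S; inv_valP : inv_val \in Ga_invariant }.

HB.instance Definition _ := [isSub for inv_val].
HB.instance Definition _ := [Choice of Ga_invariants by <:].
HB.instance Definition _ := [SubChoice_isSubComNzRing of Ga_invariants by <:].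

(* The co-ordinate morphism of the quotient Spec S -> Spec S // G_a. *)
Definition inv_incl : {rmorphism Ga_invariants -> S} := val.

End Invariants.

Section LocCoaction.
Variables (A : idomainType) (beta : {rmorphism A -> {poly A}}) (h : A).
Hypotheses (h0 : h != 0) (hinv : h \in Ga_invariant beta).

Definition loc_coaction_num : {rmorphism A -> {poly loc h}} :=
  map_poly (loc_inj h) \o beta.

Fact loc_coaction_unit : loc_coaction_num h * (loc_h_inv h0)%:P = 1.
Proof.
have /eqP hE : beta h == h%:P := hinv.
by rewrite /= hE map_polyC -polyCM loc_h_invP.
Qed.

(* a / h^n |-> beta(a) / h^n *)
Definition loc_coaction : {rmorphism loc h -> {poly loc h}} :=
  loc_lift loc_coaction_unit.

Lemma loc_coactionE (a : A) :
  loc_coaction (loc_inj h a) = map_poly (loc_inj h) (beta a).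
Proof.
rewrite /loc_coaction /= (@loc_liftE _ _ _ _ _ _ _ a 0%N) ?expr0 ?mulr1 //.
Qed.

End LocCoaction.

(* Over the base Spec S^{G_a}: an equivariant isomorphism of Spec S with
   G_a x Spec S^{G_a}, given by an isomorphism S^{G_a}[s] -> S. *)
Definition trivial_Ga_bundle (S : comNzRingType)
    (sigma : {rmorphism S -> {poly S}}) :=
  exists Psi : {rmorphism {poly Ga_invariants sigma} -> S},
    [/\ bijective Psi,
        forall b, Psi b%:P = inv_incl sigma b &
        equivariant (@translation _) sigma Psi].

Definition principle_pair (A : comNzRingType)
    (beta : {rmorphism A -> {poly A}}) (g h : A) :=
  h \in Ga_invariant beta /\ beta g = g%:P + h *: 'X.

(* For a point x with values in a field K, the orbit map G_{a,K} -> (Spec S)_K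
   has co-morphism orbit_map.  The stabilizer is its fibre over x, the closed
   subscheme of G_{a,K} = Spec K[t] defined by stabilizer_ideal. *)
Section Stabilizer.
Variables (S : comNzRingType) (sigma : {rmorphism S -> {poly S}}).

Definition orbit_map (K : fieldType) (x : {rmorphism S -> K}) (a : S) : {poly K} :=
  map_poly x (sigma a).

Definition stabilizer_ideal (K : fieldType) (x : {rmorphism S -> K}) : set {poly K} :=
  [set p | exists n (c : 'I_n -> {poly K}) (a : 'I_n -> S),
    p = \sum_(i < n) c i * (orbit_map x (a i) - (x (a i))%:P)].

(* Scheme-theoretically trivial: the stabilizer ideal is (t).  A set-theoretic
   condition would not see infinitesimal stabilizers such as alpha_p. *)
Definition trivial_stabilizer (x : spec S) :=
  forall (K : fieldType) (ev : {rmorphism S -> K}),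
    (forall a, ev a = 0 <-> spec_set x a) ->
    stabilizer_ideal ev = [set p | 'X %| p].

End Stabilizer.

(* q : S -> Q is the co-morphism of the inclusion of the closed subscheme
   V(<g>).  Q may be the zero ring. *)
Definition closed_subscheme (S : comNzRingType) (g : S) (Q : comPzRingType)
    (q : {rmorphism S -> Q}) :=
  (forall y, exists s, q s = y) /\ (forall s, q s = 0 <-> exists c, s = c * g).

(* Main.v *)
(* Write B for A_h with its coaction sigma and R for B^{G_a}.  Each of the four
   conditions is equivalent to the existence of a slice, an s in B with
   sigma(s) = s + t.  A slice gives the retraction q : b |-> sigma(b)(-s) of B
   onto R, whose kernel is (s), and B = R[s]; clearing denominators turns it
   into a principle pair.

   From (d), let pi : B -> R be the retraction with kernel (g) and let psi be
   (pi (x) id) o sigma : B -> R[t].  The kernel of psi is an invariant ideal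
   meeting R trivially, hence zero, because leading coefficients of sigma(b)
   are invariant.  Triviality of the stabilizers says that psi(g) is a nonzero
   multiple of t at every point of Spec R with values in a field, so
   psi(g) = t w with w a unit, and w^-1 g is a slice.

   For (b), the morphism k[s] -> B = R[s] is a base change of k -> R, so one has
   to see that a domain R = k[x_1, ..., x_n] is generically smooth over the
   perfect field k.  A nonzero relation of least degree between the x_i has a
   partial derivative that does not vanish at x; hence some x_i is a simple
   root of a polynomial over the subring generated by the others, Newton's
   method lifts it through square-zero extensions, and one inducts on n.  The
   fibres are connected because each contains a point specializing to all of
   its points. *)
Require Import Defs.
From HB Require Import structures.
From mathcomp Require Import all_boot all_order all_algebra.
From mathcomp Require Import boolp classical_sets.
From mathcomp Require Import topology_structure connected.
From mathcomp Require Import mpoly ring.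

Set Implicit Arguments.
Unset Strict Implicit.
Unset Printing Implicit Defensive.

Import GRing.Theory.
Local Open Scope classical_set_scope.
Local Open Scope ring_scope.

(** * Residue fields *)

(** Any set-theoretic section of [phi] serves, because [psi] is constant on the fibres of [phi]. *)
Lemma rmorphism_factor (P B C : pzRingType) (phi : {rmorphism P -> B})
    (psi : {rmorphism P -> C}) :
  (forall b, exists p, phi p = b) -> (forall p, phi p = 0 -> psi p = 0) ->
  exists chi : {rmorphism B -> C}, forall p, chi (phi p) = psi p.
Proof.
move=> /choice[sec secK] ker.
have eq_psi p p' : phi p = phi p' -> psi p = psi p'.
  by move=> e; apply/eqP; rewrite -subr_eq0 -rmorphB ker // rmorphB e subrr.
pose chi b := psi (sec b).
have chiB : zmod_morphism chi.
  by move=> x y; rewrite /chi -rmorphB; apply: eq_psi; rewrite rmorphB !secK.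
have chiM : monoid_morphism chi.
  split=> [|x y]; rewrite /chi.
    by rewrite -(rmorph1 psi); apply: eq_psi; rewrite secK rmorph1.
  by rewrite -rmorphM; apply: eq_psi; rewrite rmorphM !secK.
pose f := HB.pack_for {rmorphism B -> C} chi
  (GRing.isZmodMorphism.Build B C chi chiB)
  (GRing.isMonoidMorphism.Build B C chi chiM).
by exists f => p; apply: eq_psi; rewrite secK.
Qed.

Section ResidueField.
Local Open Scope quotient_scope.
Variables (R : comNzRingType) (M : {pred R}).
Hypothesis M_ideal : idealr_closed M.
Hypothesis M_max : forall x, x \notin M -> exists y, 1 - y * x \in M.

Definition maximal_ideal : R -> bool := fun x => x \in M.
HB.instance Definition _ := isIdealr.Build R maximal_ideal M_ideal.

Definition residue_ring := {ideal_quot (maximal_ideal : idealr R)}.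
HB.instance Definition _ := GRing.ComNzRing.on residue_ring.

Lemma residue_ring_pi_eq0 (x : R) : (\pi_residue_ring x == 0 :> residue_ring) = (x \in M).
Proof. by rewrite -(rmorph0 (\pi_residue_ring)) -Quotient.idealrBE subr0. Qed.

(** The value at 0 is prescribed too, since the field structure sets the inverse of 0 to 0. *)
Lemma residue_ring_inv_subproof (x : residue_ring) :
  exists y, (x != 0 -> y * x = 1) /\ (x = 0 -> y = 0).
Proof.
have [->|x0] := eqVneq x 0; first by exists 0; split.
have [|y yx] := M_max (x := repr x).
  by rewrite -residue_ring_pi_eq0 reprK.
exists (\pi_residue_ring y); split=> [_|/eqP]; last by rewrite (negPf x0).
apply/esym/eqP; rewrite -subr_eq0 -{1}(reprK x).
rewrite -(rmorph1 (\pi_residue_ring)) -rmorphM -rmorphB.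
by rewrite residue_ring_pi_eq0.
Qed.

Definition residue_ring_inv (x : residue_ring) : residue_ring :=
  projT1 (cid (residue_ring_inv_subproof x)).

Fact residue_ring_mulVf (x : residue_ring) : x != 0 -> residue_ring_inv x * x = 1.
Proof. by rewrite /residue_ring_inv; case: cid => /= y []. Qed.

Fact residue_ring_invr0 : residue_ring_inv 0 = 0.
Proof. by rewrite /residue_ring_inv; case: cid => /= y [_ ->]. Qed.

HB.instance Definition _ := GRing.ComNzRing_isField.Build residue_ring
  residue_ring_mulVf residue_ring_invr0.

Lemma residue_field : exists (K : fieldType) (ev : {rmorphism R -> K}),
  forall x, ev x = 0 <-> x \in M.
Proof.
exists residue_ring, \pi_residue_ring => x.
by rewrite -residue_ring_pi_eq0; split=> /eqP.
Qed.

End ResidueField.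

Lemma exists_maximal_ideal (R : comNzRingType) (w : R) :
  (forall v, v * w <> 1) ->
  exists M : {pred R}, [/\ idealr_closed M,
    forall x, x \notin M -> exists y, 1 - y * x \in M & w \in M].
Proof.
move=> nw.
(* The clause on [w] spares the empty set, so that the union of the empty chain satisfies [P]. *)
pose P (I : set R) := [/\ forall a x y, I x -> I y -> I (a * x + y),
  ~ I 1 & forall x, I x -> I w].
have [|M [[Mlin M1 Mw] Mmax]] := @Zorn_bigcup R P.
  move=> F FP Ftot; split.
  - move=> a x y [I FI Ix] [J FJ Jy].
    have [IJ|JI] := Ftot _ _ FI FJ.
      by exists J => //; have [lin _ _] := FP _ FJ; apply: lin => //; exact: IJ.
    by exists I => //; have [lin _ _] := FP _ FI; apply: lin => //; exact: JI.
  - by move=> [I /FP[]].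
  - by move=> x [I FI Ix]; exists I => //; have [_ _] := FP _ FI; apply; exact: Ix.
(* A maximal [M] without [w] would be empty, hence strictly smaller than the ideal of multiples of
   [w]. *)
have {}Mw : M w.
  apply: contrapT => nMw.
  apply: (Mmax [set c * w | c in setT]); last first.
    split.
    - move=> a _ _ [c _ <-] [d _ <-]; exists (a * c + d) => //.
      by rewrite mulrDl mulrA.
    - by move=> [c _]; exact: nw.
    - by move=> _ _; exists 1 => //; rewrite mul1r.
  split=> [x /Mw //|sub]; apply: nMw.
  by apply: sub; exists 1 => //; rewrite mul1r.
have M0 : M 0 by rewrite -(addNr w) -mulN1r; exact: Mlin.
have inM x : reflect (M x) (x \in (fun x => `[< M x >])) by exact: asboolP.
exists (fun x => `[< M x >]); split; last exact/inM.
  split; first exact/inM; first by apply/inM.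
  by move=> a x y /inM Mx /inM My; apply/inM/Mlin.
move=> x /inM nMx.
(* Otherwise [M] and [x] together generate a larger proper ideal. *)
apply: contrapT => ny.
apply: (Mmax [set m + c * x | m in M & c in setT]).
  split=> [m Mm|].
    by exists m => //; exists 0 => //; rewrite mul0r addr0.
  move=> sub; apply: nMx; apply: sub.
  by exists 0 => //; exists 1 => //; rewrite mul1r add0r.
split.
- move=> a _ _ [m Mm [c _ <-]] [m' Mm' [c' _ <-]].
  exists (a * m + m'); first exact: Mlin.
  by exists (a * c + c') => //; rewrite mulrDr mulrDl mulrA addrACA.
- move=> [m Mm [c _ e]]; apply: ny; exists c; apply/inM.
  by rewrite -e addrK.
- by move=> _ _; exists w => //; exists 0 => //; rewrite mul0r addr0.
Qed.

(** * Slices of coactions *)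

Lemma loc_hom_ext (A : idomainType) (h : A) (h0 : h != 0) (T : comNzRingType)
    (f g : {rmorphism loc h -> T}) :
  (forall a, f (loc_inj h a) = g (loc_inj h a)) -> f =1 g.
Proof.
move=> fg x; have [[a n] /= xa] := loc_fracP x.
have e : x = loc_inj h a * loc_h_inv h0 ^+ n.
  by rewrite -xa -mulrA -exprMn loc_h_invP expr1n mulr1.
have fh : f (loc_h_inv h0) = g (loc_h_inv h0).
  rewrite -[LHS]mulr1 -(rmorph1 g) -(loc_h_invP h0) rmorphM -fg.
  by rewrite mulrA -rmorphM mulrC -[X in f X]mulrC loc_h_invP rmorph1 mulr1.
by rewrite e !rmorphM !rmorphXn fg fh.
Qed.

(** The last two axioms equate ring morphisms out of [loc h], so they need only be compared on the
    image of [A]. *)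
Lemma loc_coaction_is_coaction (k : comNzRingType) (A : idomainType)
    (iota : {rmorphism k -> A}) (beta : {rmorphism A -> {poly A}})
    (h : A) (h0 : h != 0) (hinv : h \in Ga_invariant beta) :
  is_coaction iota beta ->
  is_coaction (loc_inj h \o iota) (loc_coaction h0 hinv).
Proof.
case=> bk b0 bA; split.
- by move=> c /=; rewrite loc_coactionE bk map_polyC.
- apply: (loc_hom_ext h0 (f := horner_eval 0 \o loc_coaction h0 hinv) (g := idfun)).
  move=> a; rewrite /= loc_coactionE /horner_eval -(rmorph0 (loc_inj h)).
  by rewrite horner_map b0.
- apply: (loc_hom_ext h0 (f := map_poly (loc_coaction h0 hinv) \o loc_coaction h0 hinv)
    (g := comp_poly ('X + 'X%:P) \o map_poly polyC \o loc_coaction h0 hinv)).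
  move=> a; rewrite /= loc_coactionE.
  rewrite -map_poly_comp (eq_map_poly (loc_coactionE h0 hinv)).
  rewrite (map_poly_comp (map_poly (loc_inj h))) bA.
  rewrite -[RHS]/((_)^:P \Po _) -map_poly_comp.
  rewrite map_comp_poly /= -map_poly_comp rmorphD /= map_polyX map_polyC /= map_polyX.
  congr (_ \Po _); apply: eq_map_poly => x /=.
  by rewrite map_polyC.
Qed.

Section Slice.
Variables (k S : comNzRingType) (iota : {rmorphism k -> S}).
Variables (sigma : {rmorphism S -> {poly S}}) (sigmaP : is_coaction iota sigma).
Local Notation R := (Ga_invariants sigma).
Local Notation incl := (inv_incl sigma).

Let sigma0 a : (sigma a).[0] = a. Proof. by case: sigmaP. Qed.
Let sigmaA a : map_poly sigma (sigma a) = (sigma a)^:P \Po ('X + 'X%:P).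
Proof. by case: sigmaP. Qed.

Lemma sigma_incl (r : R) : sigma (incl r) = (incl r)%:P.
Proof. by have := inv_valP r; rewrite unfold_in => /eqP. Qed.

Definition is_slice (s : S) := sigma s = s%:P + 'X.

(** For a slice [s] this is the Dixmier map: geometrically, each point [x] moves by [- s(x)] along
    its orbit into the zero locus of [s]. *)
Definition dixmier_val (s : S) : {rmorphism S -> S} := horner_eval (- s) \o sigma.

Section Dixmier.
Variables (s : S) (sP : is_slice s).

(** By coassociativity the coaction sends sigma(b)(-s) to sigma(b) evaluated at t - (s + t) = -s. *)
Lemma dixmier_inv b : dixmier_val s b \in Ga_invariant sigma.
Proof.
rewrite unfold_in /= /horner_eval; apply/eqP.
rewrite -horner_map /= sigmaA horner_comp rmorphN /= sP.
by rewrite !hornerE opprD subrK -polyCN horner_map.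
Qed.

Definition dixmier b : R := Invariants (dixmier_inv b).

Fact dixmier_zmod_morphism : zmod_morphism dixmier.
Proof. by move=> a b; apply: val_inj; rewrite /= !rmorphB. Qed.
Fact dixmier_monoid_morphism : monoid_morphism dixmier.
Proof. by split=> [|a b]; apply: val_inj; rewrite /= ?rmorph1 ?rmorphM. Qed.

HB.instance Definition _ := GRing.isZmodMorphism.Build S R dixmier
  dixmier_zmod_morphism.
HB.instance Definition _ := GRing.isMonoidMorphism.Build S R dixmier
  dixmier_monoid_morphism.

Lemma dixmier_incl r : dixmier (incl r) = r.
Proof. by apply: val_inj; rewrite /= sigma_incl /horner_eval hornerC. Qed.

Lemma dixmier_slice : dixmier s = 0.
Proof.
by apply: val_inj; rewrite /= sP /horner_eval !hornerE subrr.
Qed.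

(** The root -s splits off a factor t + s from sigma(b); setting t = 0 leaves a multiple of [s]. *)
Lemma dixmier_eq0 b : dixmier b = 0 <-> exists c, b = c * s.
Proof.
split=> [b0|[c ->]]; last by rewrite rmorphM /= dixmier_slice mulr0.
have : (sigma b).[- s] = 0 by move/(congr1 val): b0.
move=> /eqP /factor_theorem[p bp]; exists p.[0].
by rewrite -[LHS]sigma0 bp !hornerE opprK.
Qed.

Definition slice_trivialization : {rmorphism {poly R} -> S} :=
  horner_eval s \o map_poly incl.

Lemma slice_trivializationC r : slice_trivialization r%:P = incl r.
Proof. by rewrite /slice_trivialization /= (map_polyC incl) /horner_eval hornerC. Qed.

Lemma slice_trivializationX : slice_trivialization 'X = s.
Proof. by rewrite /slice_trivialization /= (map_polyX incl) /horner_eval hornerX. Qed.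

(** The inverse applies the Dixmier map to the coefficients of sigma(b). One composite is the
    identity because the Dixmier map kills [s] and fixes invariants, the other because
    coassociativity turns it into sigma(b)(-s + s) = b. *)
Lemma slice_trivialization_bij : bijective slice_trivialization.
Proof.
exists (map_poly dixmier \o sigma) => [p|b] /=.
  rewrite /horner_eval -!horner_map /= -!map_poly_comp.
  rewrite (eq_map_poly (g := polyC)); last first.
    by move=> r /=; rewrite sigma_incl map_polyC /= dixmier_incl.
  rewrite sP rmorphD /= map_polyX map_polyC /= dixmier_slice polyC0 add0r.
  exact: comp_polyXr.
rewrite /horner_eval -(map_poly_comp incl).
rewrite (eq_map_poly (g := horner_eval (- s) \o sigma)) //.
(* Evaluating the coefficients at [- s] commutes with evaluating the outer variable at [s]. *)
have evE (P : {poly {poly S}}) : (map_poly (horner_eval (- s)) P).[s] = P.[s%:P].[- s].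
  rewrite -[RHS]/(horner_eval (- s) P.[s%:P]) -horner_map /=.
  by rewrite [horner_eval _ s%:P]hornerC.
rewrite map_poly_comp sigmaA evE horner_comp !hornerE.
have -> : ((sigma b)^:P).[s%:P + 'X] = sigma b \Po (s%:P + 'X) by [].
by rewrite horner_comp !hornerE subrr sigma0.
Qed.

Lemma slice_trivial : trivial_Ga_bundle sigma.
Proof.
exists slice_trivialization; split.
- exact: slice_trivialization_bij.
- exact: slice_trivializationC.
move=> p; rewrite -[LHS]/(sigma (map_poly incl p).[s]) -horner_map sP.
rewrite -[RHS]/(map_poly _ (p^:P \Po _)) map_comp_poly.
have -> : map_poly slice_trivialization ('X + 'X%:P) = s%:P + 'X.
  rewrite addrC -slice_trivializationX rmorphD; congr (_ + _).
    exact: map_polyC.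
  exact: map_polyX.
rewrite /comp_poly -!map_poly_comp; congr (_.[_]); apply: eq_map_poly => r.
by rewrite -[RHS]/(slice_trivialization r%:P)%:P slice_trivializationC -sigma_incl.
Qed.

End Dixmier.

Lemma trivial_slice : trivial_Ga_bundle sigma -> exists s, is_slice s.
Proof.
case=> Psi [_ Psib Psie]; exists (Psi 'X).
rewrite /is_slice Psie /translation map_polyX comp_polyX rmorphD /=.
by rewrite map_polyX map_polyC /= addrC.
Qed.

(** Translation sends the coordinate of the additive group to itself plus t, and equivariance
    transports this identity. *)
Lemma equivariant_slice (K : comNzRingType) (Phi : {rmorphism {poly K} -> S}) :
  equivariant (@translation K) sigma Phi -> is_slice (Phi 'X).
Proof.
move=> /(_ 'X); rewrite /is_slice /translation map_polyX comp_polyX rmorphD /=.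
by rewrite map_polyX map_polyC /= addrC.
Qed.

(** At t = 0 the orbit map returns the point, so t divides every generator; the generator coming
    from [s] is t itself. *)
Lemma slice_stabilizer s x : is_slice s -> trivial_stabilizer sigma x.
Proof.
move=> sP K ev evP; apply/seteqP; split=> p /=.
  move=> [n [c [a ->]]]; apply: (big_ind (fun p => 'X %| p)) => [|x1 x2|i _].
  - exact: dvdp0.
  - exact: dvdp_add.
  apply: dvdp_mull; rewrite -['X]subr0 -polyC0 dvdp_XsubCl /root hornerD hornerN hornerC.
  by rewrite /orbit_map -[X in _.[X]](rmorph0 ev) horner_map sigma0 subrr.
move=> /dvdpP[q ->]; exists 1%N, (fun=> q), (fun=> s).
rewrite big_ord1 /orbit_map sP rmorphD /= map_polyX map_polyC /=.
by rewrite addrAC subrr add0r.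
Qed.

End Slice.

Section GenericPoint.
Variable B : idomainType.

Fact zero_ideal : idealr_closed [pred a in [set 0 : B]].
Proof.
split; rewrite ?inE //; first by apply/negP; rewrite inE => /eqP; rewrite oner_eq0.
by move=> a u v; rewrite !inE => -> ->; rewrite mulr0 addr0.
Qed.

Fact zero_ideal_prime : prime_idealr_closed [pred a in [set 0 : B]].
Proof.
move=> u v; rewrite inE => /eqP; rewrite mulf_eq0.
by case/orP => /eqP ->; apply/orP; [left|right]; rewrite inE.
Qed.

Definition generic_point : spec B := Spec zero_ideal zero_ideal_prime.

End GenericPoint.

(** * From trivial stabilizers to a slice *)

Section StabilizerSlice.
Variables (k : comNzRingType) (S : idomainType) (iota : {rmorphism k -> S}).
Variables (sigma : {rmorphism S -> {poly S}}) (sigmaP : is_coaction iota sigma).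
Local Notation R := (Ga_invariants sigma).
Local Notation incl := (inv_incl sigma).

Variables (g : S) (pi : {rmorphism S -> R}).
Hypothesis pi_incl : forall r, pi (incl r) = r.
Hypothesis pi_eq0 : forall b, pi b = 0 <-> exists c, b = c * g.
Hypothesis stab : forall x : spec S, spec_set x g -> trivial_stabilizer sigma x.

(** The co-morphism of the action map from the product of the additive group and V(g) to Spec S,
    with V(g) identified with the quotient through [pi]. *)
Let psi : {rmorphism S -> {poly R}} := map_poly pi \o sigma.

Let sigma0 a : (sigma a).[0] = a. Proof. by case: sigmaP. Qed.
Let sigmaA a : map_poly sigma (sigma a) = (sigma a)^:P \Po ('X + 'X%:P).
Proof. by case: sigmaP. Qed.

Let psi_incl r : psi (incl r) = r%:P.
Proof. by rewrite /psi /= sigma_incl map_polyC /= pi_incl. Qed.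

Let psi_equivariant b : map_poly psi (sigma b) = (psi b)^:P \Po ('X + 'X%:P).
Proof.
rewrite /psi /= map_poly_comp sigmaA map_comp_poly -map_poly_comp rmorphD /=.
rewrite map_polyX map_polyC /= map_polyX -map_poly_comp; congr (_ \Po _).
by apply: eq_map_poly => x /=; rewrite map_polyC.
Qed.

(** Compare the top coefficients in the outer variable on both sides of coassociativity:
    substituting a monic polynomial of degree one changes neither degree nor leading coefficient. *)
Lemma lead_coef_coaction_invariant b : lead_coef (sigma b) \in Ga_invariant sigma.
Proof.
rewrite unfold_in; apply/eqP.
have sz : size ('X + 'X%:P : {poly {poly S}}) = 2 by rewrite size_XaddC.
have := congr1 (fun p : {poly {poly S}} => p`_(size (sigma b)).-1) (sigmaA b); rewrite /= coef_map /=.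
rewrite -lead_coefE => ->.
have szP : size ((sigma b)^:P \Po ('X + 'X%:P)) = size (sigma b).
  by rewrite size_comp_poly2 // size_map_polyC.
rewrite -{1}szP -lead_coefE lead_coef_comp ?sz //.
by rewrite lead_coefXaddC expr1n mulr1 lead_coef_map_inj //; exact: polyC_inj.
Qed.

(** If psi(b) = 0, equivariance makes [psi] kill the leading coefficient of sigma(b). This is an
    invariant, and [psi] is injective on invariants, so sigma(b) = 0. *)
Let psi_inj : injective psi.
Proof.
apply: raddf_inj => b b0; apply/eqP; apply: contraT => bn0.
pose c : R := Invariants (lead_coef_coaction_invariant b).
have : (map_poly psi (sigma b))`_(size (sigma b)).-1 = 0.
  by rewrite psi_equivariant b0 rmorph0 comp_poly0 coef0.
rewrite coef_map /= -lead_coefE -[lead_coef _]/(incl c) => psic0.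
have := psi_incl c; rewrite /psi /= psic0 => /esym /eqP.
rewrite polyC_eq0 => /eqP /(congr1 val)/= /eqP; rewrite lead_coef_eq0 => /eqP sb0.
by case/eqP: bn0; rewrite -(sigma0 b) sb0 horner0.
Qed.

(** Modulo invariants every element is a multiple of [g], so the image of psi(g) divides all
    generators of the stabilizer ideal, hence t. Its constant term vanishes because [pi] kills
    [g]. *)
Let psi_g_point (K : fieldType) (phi : {rmorphism R -> K}) :
  map_poly phi (psi g) = phi (psi g)`_1 *: 'X /\ phi (psi g)`_1 != 0.
Proof.
pose ev : {rmorphism S -> K} := phi \o pi.
have pig : pi g = 0 by apply/pi_eq0; exists 1; rewrite mul1r.
have evE a : orbit_map sigma ev a = map_poly phi (psi a).
  by rewrite /orbit_map /ev /psi /= map_poly_comp.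
have := stab (x := comap ev (generic_point K)).
rewrite /= pig rmorph0 => /(_ erefl K ev) stabP.
have : stabilizer_ideal sigma ev 'X.
  by rewrite stabP //= dvdpp.
case=> n [c [a Xe]].
have dX : map_poly phi (psi g) %| 'X.
  rewrite Xe; apply: (big_ind (fun p => _ %| p)) => [|x1 x2|i _].
  - exact: dvdp0.
  - exact: dvdp_add.
  apply: dvdp_mull.
  have [|b ab] := (pi_eq0 (a i - incl (pi (a i)))).1.
    by rewrite rmorphB pi_incl subrr.
  have {ab} -> : a i = b * g + incl (pi (a i)) by rewrite -ab subrK.
  rewrite evE; move: (pi (a i)) => r.
  have -> : psi (b * g + incl r) = psi b * psi g + r%:P.
    by rewrite rmorphD rmorphM psi_incl.
  have -> : ev (b * g + incl r) = phi r.
    by rewrite /ev /= rmorphD rmorphM pig pi_incl mulr0 add0r.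
  by rewrite rmorphD rmorphM /= map_polyC /= addrK dvdp_mull.
have r0 : (map_poly phi (psi g))`_0 = 0.
  by rewrite coef_map /= -horner_coef0 -(rmorph0 pi) horner_map /= sigma0 pig rmorph0.
have n0 : map_poly phi (psi g) != 0.
  by apply: contraTneq dX => ->; rewrite dvd0p polyX_eq0.
have sz : (size (map_poly phi (psi g)) <= 2)%N.
  by have := dvdp_leq _ dX; rewrite size_polyX polyX_eq0; apply.
have e : map_poly phi (psi g) = phi (psi g)`_1 *: 'X.
  apply/polyP => -[|[|i]].
  - by rewrite r0 coefZ coefX mulr0.
  - by rewrite coefZ coefX mulr1 coef_map.
  - by rewrite coefZ coefX mulr0 nth_default // (leq_trans sz).
split=> //; apply: contraNneq n0 => p0.
by rewrite e p0 scale0r.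
Qed.

Lemma stabilizer_slice : exists s, is_slice sigma s.
Proof.
pose w := (psi g)`_1.
(* The generic point is injective on [R], which gives psi(g) = w t over [R] itself. *)
pose phi : {rmorphism R -> {fraction S}} := @tofrac S \o incl.
have [gen _] := psi_g_point phi.
have phi_inj : injective phi.
  by move=> r r' /eqP; rewrite tofrac_eq => /eqP; exact: val_inj.
have psig : psi g = w *: 'X.
  apply: (map_inj_poly phi_inj (rmorph0 phi)).
  rewrite gen -!mul_polyC rmorphM; congr (_ * _); apply/esym.
    exact: map_polyC.
  exact: map_polyX.
(* A non-unit [w] would vanish in the residue field of a maximal ideal. *)
have [v vw] : exists v, v * w = 1.
  apply: contrapT => /forallNP /exists_maximal_ideal[M [Mi Mmax wM]].
  have [K [ev evP]] := residue_field Mi Mmax.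
  by have [_ /eqP[]] := psi_g_point ev; apply/evP.
exists (incl v * g); rewrite /is_slice.
have ps : psi (incl v * g) = 'X.
  by rewrite rmorphM psi_incl psig -mul_polyC mulrA -polyCM vw mul1r.
(* As [psi] is injective and equivariant, the slice identity may be checked on the image ['X]. *)
apply: (map_inj_poly psi_inj (rmorph0 psi)).
rewrite psi_equivariant [psi _]ps map_polyX comp_polyX rmorphD addrC.
by congr (_ + _); apply/esym; [rewrite -ps; exact: map_polyC | exact: map_polyX].
Qed.

End StabilizerSlice.

(** * Finite presentation over noetherian rings *)

Lemma mpoly_ring_ind n (R : comNzRingType) (P : {mpoly R[n]} -> Prop) :
  (forall c, P c%:MP) -> (forall i, P 'X_i) ->
  (forall p q, P p -> P q -> P (p + q)) -> (forall p q, P p -> P q -> P (p * q)) ->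
  forall p, P p.
Proof.
move=> PC PX PD PM p; rewrite [p]mpolyE.
apply: (big_ind P) => [|//|m _]; first by rewrite -mpolyC0.
rewrite -mul_mpolyC mpolyXE_id; apply: (PM) => //.
apply: (big_ind P) => [|//|i _]; first by rewrite -mpolyC1.
elim: (m i) => [|d IHd]; first by rewrite expr0 -mpolyC1.
by rewrite exprS; apply: PM.
Qed.

Lemma mmapXi n (R S : comNzRingType) (f : {rmorphism R -> S}) (x : 'I_n -> S) i :
  mmap f x 'X_i = x i.
Proof. by rewrite mmapX mmap1U. Qed.

Lemma mpoly_hom_ext n (R : comNzRingType) (S : comNzRingType)
    (f g : {rmorphism {mpoly R[n]} -> S}) :
  (forall c, f c%:MP = g c%:MP) -> (forall i, f 'X_i = g 'X_i) -> f =1 g.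
Proof.
move=> fgC fgX; apply: mpoly_ring_ind => // p q fp fq.
  by rewrite !rmorphD fp fq.
by rewrite !rmorphM fp fq.
Qed.

Section Noetherian.

Definition is_ideal (R : comNzRingType) (I : set R) :=
  I 0 /\ forall a x y, I x -> I y -> I (a * x + y).

(** Generation of [I] by [s] is phrased as minimality among the ideals containing [s], which avoids
    linear combinations. *)
Definition noetherian (R : comNzRingType) :=
  forall I : set R, is_ideal I -> exists s : seq R,
    (forall x, x \in s -> I x) /\
    forall J, is_ideal J -> (forall x, x \in s -> J x) -> I `<=` J.

Lemma noetherian_field (k : fieldType) : noetherian k.
Proof.
move=> I [I0 Ilin]; have [[x Ix x0]|nI] := pselect (exists2 x, I x & x != 0).
  exists [:: x]; split=> [y|J [J0 Jlin] Js y _]; first by rewrite inE => /eqP->.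
  rewrite -[y]addr0 -[y](divfK x0); apply: Jlin => //.
  by apply: Js; rewrite inE.
exists [::]; split=> // J [J0 _] _ x Ix.
by have [-> //|x0] := eqVneq x 0; case: nI; exists x.
Qed.

Lemma noetherian_surj (R S : comNzRingType) (f : {rmorphism R -> S}) :
  (forall y, exists x, f x = y) -> noetherian R -> noetherian S.
Proof.
move=> fsurj Rn I [I0 Ilin].
have [|s [sI sgen]] := Rn (f @^-1` I).
  split=> [|a x y] /=; first by rewrite rmorph0.
  by rewrite rmorphD rmorphM; exact: Ilin.
exists (map f s); split=> [_ /mapP[x /sI Ix ->] //|J [J0 Jlin] Js y Iy].
have [x xy] := fsurj y; rewrite -xy; apply: (sgen (f @^-1` J)).
- split=> [|a u v] /=; first by rewrite rmorph0.
  by rewrite rmorphD rmorphM; exact: Jlin.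
- by move=> u us; apply: Js; exact: map_f.
- by rewrite /= xy.
Qed.

(** * Hilbert's basis theorem *)

Section HilbertBasis.
Variables (R : comNzRingType) (Rn : noetherian R) (I : set {poly R}).
Hypothesis Iideal : is_ideal I.

(** Leading coefficients in degree [d]; admitting lower degrees contributes only 0 and makes this an
    ideal. *)
Definition coef_ideal (J : set {poly R}) d : set R :=
  [set r | exists f, [/\ J f, (size f <= d.+1)%N & f`_d = r]].

Lemma coef_ideal_is_ideal J d : is_ideal J -> is_ideal (coef_ideal J d).
Proof.
move=> [J0 Jlin]; split=> [|a _ _ [f [Jf sf <-]] [g [Jg sg <-]]].
  by exists 0; rewrite size_poly0 coef0.
exists (a%:P * f + g); rewrite coefD coefCM; split=> //; first exact: Jlin.
rewrite (leq_trans (size_polyD _ _)) // geq_max sg andbT.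
by rewrite mul_polyC (leq_trans (size_scale_leq _ _)).
Qed.

Lemma coef_ideal_shift J d e : is_ideal J -> (d <= e)%N ->
  coef_ideal J d `<=` coef_ideal J e.
Proof.
move=> [J0 Jlin] de _ [f [Jf sf <-]]; exists ('X^(e - d) * f); split.
- by rewrite -[_ * f]addr0; apply: Jlin.
- rewrite (leq_trans (size_polyMleq _ _)) // size_polyXn addSn /=.
  by rewrite (leq_trans (leq_add (leqnn _) sf)) // addnS subnK.
- by rewrite coefXnM ltnNge leq_subr /= subKn.
Qed.

(* Once every leading coefficient occurring in [I] occurs in [I `&` J] at the
   same degree, subtracting leading terms shows [I `<=` J]. *)
Lemma coef_ideal_subset J : is_ideal J ->
  (forall d, coef_ideal I d `<=` coef_ideal (I `&` J) d) -> I `<=` J.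
Proof.
move=> [J0 Jlin] IJ p; have [n] := ubnP (size p); case: Iideal => I0 Ilin.
elim: n p => // n IHn p; rewrite ltnS => sp Ip.
have [sp0|] := posnP (size p).
  by move/eqP: sp0; rewrite size_poly_eq0 => /eqP ->.
case sp1 : (size p) => [//|d] _.
have [|f [[If Jf] sf fd]] := IJ d p`_d; first by exists p; rewrite sp1.
rewrite -(subrK f p) addrC -[f]mul1r; apply: Jlin => //.
have pfE : p - 1 * f = -1 * f + p by rewrite mulN1r mul1r addrC.
apply: IHn; last by rewrite pfE; exact: Ilin.
apply: leq_trans sp; rewrite sp1 ltnS; apply/leq_sizeP => j.
rewrite mul1r coefB leq_eqVlt => /orP[/eqP <-|dj]; first by rewrite fd subrr.
by rewrite !nth_default ?subrr // ?sp1 // (leq_trans sf).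
Qed.

Lemma coef_ideal_lift (s : seq R) d : (forall r, r \in s -> coef_ideal I d r) ->
  exists t : seq {poly R}, (forall f, f \in t -> I f) /\
   forall J, (forall f, f \in t -> J f) -> forall r, r \in s -> coef_ideal (I `&` J) d r.
Proof.
elim: s => [|r s IHs] sI; first by exists [::].
have [|t [tI tJ]] := IHs; first by move=> x xs; apply: sI; rewrite inE xs orbT.
have [|f [If sf fd]] := sI r; first by rewrite inE eqxx.
exists (f :: t); split=> [g|J fJ x].
  by rewrite inE => /orP[/eqP ->|/tI].
rewrite inE => /orP[/eqP ->|xs].
  by exists f; split=> //; split=> //; apply: fJ; rewrite inE eqxx.
by apply: tJ => // g gt; apply: fJ; rewrite inE gt orbT.
Qed.

Let II J : is_ideal J -> is_ideal (I `&` J).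
Proof.
move=> [J0 Jlin]; case: Iideal => I0 Ilin; split=> // a x y [Ix Jx] [Iy Jy].
by split; [exact: Ilin|exact: Jlin].
Qed.

Lemma coef_ideal_fg d : exists t : seq {poly R}, (forall f, f \in t -> I f) /\
  forall J, is_ideal J -> (forall f, f \in t -> J f) ->
    coef_ideal I d `<=` coef_ideal (I `&` J) d.
Proof.
have [s [sI sgen]] := Rn (coef_ideal_is_ideal d Iideal).
have [t [tI tJ]] := coef_ideal_lift sI; exists t; split=> // J Ji Jt.
by apply: sgen; [exact/coef_ideal_is_ideal/II|exact: tJ].
Qed.

(** Before the coefficient ideals become stationary, each degree needs its own generators. *)
Lemma coef_ideal_fg_lt N : exists t : seq {poly R}, (forall f, f \in t -> I f) /\
  forall J, is_ideal J -> (forall f, f \in t -> J f) ->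
    forall d, (d < N)%N -> coef_ideal I d `<=` coef_ideal (I `&` J) d.
Proof.
elim: N => [|N [t [tI tJ]]]; first by exists [::].
have [t' [t'I t'J]] := coef_ideal_fg N; exists (t ++ t'); split.
  by move=> f; rewrite mem_cat => /orP[/tI|/t'I].
move=> J Ji Jt d; rewrite ltnS leq_eqVlt => /orP[/eqP ->|dN].
  by apply: t'J => // f ft; apply: Jt; rewrite mem_cat ft orbT.
by apply: tJ => // f ft; apply: Jt; rewrite mem_cat ft.
Qed.

(** The increasing coefficient ideals have a finitely generated union, so they are constant from
    some [N] on. Lifts [t] of generators in degree [N] handle all degrees from [N] on, and [u]
    handles the finitely many below. *)
Lemma hilbert_basis_subproof : exists s : seq {poly R},
  (forall x, x \in s -> I x) /\
  forall J, is_ideal J -> (forall x, x \in s -> J x) -> I `<=` J.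
Proof.
have Li : is_ideal (\bigcup_d coef_ideal I d).
  split; first by exists 0%N => //; exact: (coef_ideal_is_ideal 0 Iideal).1.
  move=> a x y [d _ Ix] [e _ Iy]; exists (maxn d e) => //.
  apply: (coef_ideal_is_ideal _ Iideal).2.
    exact: (coef_ideal_shift Iideal (leq_maxl d e)).
  exact: (coef_ideal_shift Iideal (leq_maxr d e)).
have [s [sI sgen]] := Rn Li.
have [N sN] : exists N, forall r, r \in s -> coef_ideal I N r.
  elim: s sI {sgen} => [|r s IHs] sI; first by exists 0%N.
  have [|N sN] := IHs; first by move=> x xs; apply: sI; rewrite inE xs orbT.
  have [|d _ dr] := sI r; first by rewrite inE eqxx.
  exists (maxn d N) => x; rewrite inE => /orP[/eqP ->|/sN].
    exact: (coef_ideal_shift Iideal (leq_maxl d N)).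
  exact: (coef_ideal_shift Iideal (leq_maxr d N)).
have [t [tI tJ]] := coef_ideal_lift sN.
have [u [uI uJ]] := coef_ideal_fg_lt N.
exists (t ++ u); split; first by move=> f; rewrite mem_cat => /orP[/tI|/uI].
move=> J Ji Jtu; apply: coef_ideal_subset => // d.
have [dN|Nd] := ltnP d N.
  by apply: uJ => // f fu; apply: Jtu; rewrite mem_cat fu orbT.
move=> r Ir; apply: (sgen (coef_ideal (I `&` J) d)); last by exists d.
  exact/coef_ideal_is_ideal/II.
move=> x xs; apply: (coef_ideal_shift (II Ji) Nd); apply: tJ xs.
by move=> f ft; apply: Jtu; rewrite mem_cat ft.
Qed.

End HilbertBasis.

Lemma hilbert_basis (R : comNzRingType) : noetherian R -> noetherian {poly R}.
Proof. by move=> Rn I; exact: hilbert_basis_subproof. Qed.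

(** Adding the last variable gives a quotient of a univariate polynomial ring over the previous
    one. *)
Lemma noetherian_mpoly n (R : comNzRingType) : noetherian R -> noetherian {mpoly R[n]}.
Proof.
move=> Rn; elim: n => [|n IHn].
  apply: (noetherian_surj (f := @mpolyC 0 R)) Rn.
  apply: mpoly_ring_ind => [c|[]//|_ _ [x <-] [y <-]|_ _ [x <-] [y <-]].
  - by exists c.
  - by exists (x + y); rewrite rmorphD.
  - by exists (x * y); rewrite rmorphM.
pose w : {rmorphism {mpoly R[n]} -> {mpoly R[n.+1]}} :=
  mmap (@mpolyC n.+1 R) (fun j => 'X_(lift ord_max j)).
pose f : {rmorphism {poly {mpoly R[n]}} -> {mpoly R[n.+1]}} :=
  horner_eval 'X_ord_max \o map_poly w.
apply: (noetherian_surj (f := f)) (hilbert_basis IHn).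
apply: mpoly_ring_ind => [c|i|_ _ [x <-] [y <-]|_ _ [x <-] [y <-]].
- by exists c%:MP%:P; rewrite /f /= map_polyC /horner_eval hornerC /= mmapC.
- case: (unliftP ord_max i) => [j|] ->.
    by exists ('X_j)%:P; rewrite /f /= map_polyC /horner_eval hornerC /= mmapXi.
  by exists 'X; rewrite /f /= map_polyX /horner_eval hornerX.
- by exists (x + y); rewrite rmorphD.
- by exists (x * y); rewrite rmorphM.
Qed.

Lemma noetherian_finite_presentation (R S : comNzRingType) (f : {rmorphism R -> S}) :
  noetherian R -> finite_type f -> finite_presentation f.
Proof.
move=> Rn [n [x xsurj]]; exists n, x.
have [|s [sI sgen]] := @noetherian_mpoly n _ Rn [set p | mmap f x p = 0].
  split=> [|a p q] /=; first by rewrite rmorph0.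
  by move=> p0 q0; rewrite rmorphD rmorphM /= p0 q0 mulr0 addr0.
exists (size s), (fun i => s`_i); split=> // p; split=> [p0|[c ->]]; last first.
  rewrite rmorph_sum big1 // => i _; rewrite rmorphM /=.
  by rewrite [mmap f x s`_i]sI ?mulr0 // mem_nth.
apply: (sgen [set p | exists c : 'I_(size s) -> _, p = \sum_(i < size s) c i * s`_i]) p0.
  split=> [|a _ _ [c ->] [d ->]].
    by exists (fun=> 0); rewrite big1 // => i _; rewrite mul0r.
  exists (fun i => a * c i + d i); rewrite mulr_sumr -big_split.
  by apply: eq_bigr => i _; rewrite mulrDl mulrA.
move=> q qs; have qi : (index q s < size s)%N by rewrite index_mem.
exists (fun i => (i == Ordinal qi)%:R).
rewrite (bigD1 (Ordinal qi)) //= eqxx mul1r nth_index //.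
by rewrite big1 ?addr0 // => i /negPf ->; rewrite mul0r.
Qed.

End Noetherian.

(** * Generic smoothness over an algebraically closed field *)

Section SquareZero.
Variables (C D : comNzRingType) (pi : {rmorphism C -> D}).
Hypothesis pi_surj : forall d, exists c, pi c = d.
Hypothesis pi_sq0 : forall c c', pi c = 0 -> pi c' = 0 -> c * c' = 0.

(** With e = v' u - 1 of square zero, (1 - e)(1 + e) = 1. *)
Lemma sq0_lift_unit u v : v * pi u = 1 -> exists w, w * u = 1.
Proof.
have [v' <-] := pi_surj v => vu.
have e0 : pi (v' * u - 1) = 0 by rewrite rmorphB rmorphM vu rmorph1 subrr.
exists ((1 - (v' * u - 1)) * v').
have -> : (1 - (v' * u - 1)) * v' * u = 1 - (v' * u - 1) * (v' * u - 1) by ring.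
by rewrite pi_sq0 // subr0.
Qed.

Lemma horner_taylor1 (p : {poly C}) x e : exists q,
  p.[x + e] = p.[x] + e * p^`().[x] + e * e * q.
Proof.
elim/poly_ind: p => [|p c [q pE]].
  by exists 0; rewrite deriv0 !horner0 !mulr0 !addr0.
exists (q * (x + e) + p^`().[x]).
by rewrite derivD derivM derivX derivC addr0 mulr1 !hornerE pE; ring.
Qed.

(** One Newton step reaches an exact root, as the remainder is a multiple of the square of a kernel
    element. *)
Lemma sq0_newton (p : {poly C}) c0 v :
  pi p.[c0] = 0 -> v * pi p^`().[c0] = 1 -> exists c, pi c = pi c0 /\ p.[c] = 0.
Proof.
move=> p0 /sq0_lift_unit[w wp].
have e0 : pi (- (w * p.[c0])) = 0 by rewrite rmorphN rmorphM p0 mulr0 oppr0.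
exists (c0 + - (w * p.[c0])); split; first by rewrite rmorphD e0 addr0.
have [q ->] := horner_taylor1 p c0 (- (w * p.[c0])).
have -> : - (w * p.[c0]) * p^`().[c0] = - (w * p^`().[c0]) * p.[c0] by ring.
by rewrite wp (pi_sq0 e0 e0) mul0r addr0 mulN1r subrr.
Qed.

End SquareZero.

Section PolyAt.
Variables (T F : comNzRingType) (e : {rmorphism T -> F}) (a : F).

Definition poly_at : {rmorphism {poly T} -> F} := horner_eval a \o map_poly e.

Lemma poly_atC c : poly_at c%:P = e c.
Proof. by rewrite /poly_at /= map_polyC /horner_eval hornerC. Qed.

Lemma poly_atX : poly_at 'X = a.
Proof. by rewrite /poly_at /= map_polyX /horner_eval hornerX. Qed.

Lemma poly_at_eq0 (Q : {poly T}) : (forall i, e Q`_i = 0) -> poly_at Q = 0.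
Proof.
move=> Qk; rewrite /poly_at /=; suff -> : map_poly e Q = 0 by rewrite /horner_eval horner0.
by apply/polyP => i; rewrite coef_map /= Qk coef0.
Qed.

End PolyAt.

(** * Minimal polynomials up to denominators *)

Section SimpleRoot.
Variables (T F : idomainType) (e : {rmorphism T -> F}) (a : F).
Local Notation poly_at := (poly_at e a).

(** Since [e] may have a kernel, the leading coefficient is tested after applying [e]: the degree
    survives over the image. *)
Definition root_candidate (M : {poly T}) := poly_at M = 0 /\ e (lead_coef M) != 0.

(** Leading terms killed by [e] are stripped off one by one. *)
Lemma root_candidate_or_killed (Q : {poly T}) : poly_at Q = 0 ->
  (exists2 M, root_candidate M & (size M <= size Q)%N) \/ (forall i, e Q`_i = 0).
Proof.
have [n] := ubnP (size Q); elim: n Q => // n IHn Q; rewrite ltnS => sQ Q0.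
have [Q00|Qn0] := eqVneq Q 0; first by right=> i; rewrite Q00 coef0 rmorph0.
have [l0|ln0] := eqVneq (e (lead_coef Q)) 0; last by left; exists Q.
have szQ : (0 < size Q)%N by rewrite size_poly_gt0.
pose t : {poly T} := lead_coef Q *: 'X^((size Q).-1).
have sQt : (size (Q - t)%R < size Q)%N.
  rewrite -[X in (_ < X)%N](prednK szQ) ltnS; apply/leq_sizeP => j.
  rewrite coefB coefZ coefXn leq_eqVlt => /orP[/eqP <-|ltj].
    by rewrite eqxx mulr1 subrr.
  by rewrite gtn_eqF // mulr0 subr0 nth_default // -(prednK szQ).
have t0 i : e t`_i = 0 by rewrite coefZ rmorphM l0 mul0r.
have [||[M Mc sM]|Qt] := IHn (Q - t).
- exact: leq_trans sQt sQ.
- by rewrite rmorphB Q0 sub0r /t -mul_polyC rmorphM poly_atC l0 mul0r oppr0.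
- by left; exists M => //; rewrite (leq_trans sM) // ltnW.
- by right=> i; have := Qt i; rewrite coefB rmorphB t0 subr0.
Qed.

(** Take [M] of least size. A pseudo-remainder by [M] that vanishes at [a] is too short to be a
    candidate, so [e] kills it. Differentiating the division of [G] at [a] shows that the derivative
    of [M] cannot vanish there. *)
Lemma simple_root_generator (G : {poly T}) : poly_at G = 0 -> poly_at G^`() != 0 ->
  exists M, [/\ root_candidate M, poly_at M^`() != 0 &
    forall Q, poly_at Q = 0 -> exists m S Rm,
      lead_coef M ^+ m *: Q = S * M + Rm /\ forall i, e Rm`_i = 0].
Proof.
move=> G0 G'0.
have killed' (Q : {poly T}) : (forall i, e Q`_i = 0) -> poly_at Q^`() = 0.
  by move=> Qk; apply: poly_at_eq0 => i; rewrite coef_deriv rmorphMn Qk mul0rn.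
pose P n := `[< exists2 M, root_candidate M & size M = n >].
have exP : exists n, P n.
  have [[M Mc _]|Gk] := root_candidate_or_killed G0.
    by exists (size M); apply/asboolP; exists M.
  by case/eqP: G'0; exact: killed'.
case: (ex_minnP exP) => n /asboolP[M Mc sM] Mmin; exists M.
have Mdiv Q : poly_at Q = 0 -> exists m S Rm,
    lead_coef M ^+ m *: Q = S * M + Rm /\ forall i, e Rm`_i = 0.
  move=> Q0; exists (scalp Q M), (Q %/ M), (Q %% M); split; first exact: Pdiv.Idomain.divp_eq.
  have Qm0 : poly_at (Q %% M) = 0.
    have := congr1 poly_at (Pdiv.Idomain.divp_eq Q M).
    by rewrite -mul_polyC rmorphD !rmorphM Q0 Mc.1 !mulr0 add0r.
  have [[N Nc sN]|//] := root_candidate_or_killed Qm0.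
  have Mn0 : M != 0 by apply: contraNneq Mc.2 => ->; rewrite lead_coef0 rmorph0.
  have := leq_ltn_trans sN; rewrite -(ltn_modp Q) in Mn0 => /(_ _ Mn0).
  by rewrite sM ltnNge Mmin //; apply/asboolP; exists N.
split=> //; have [m [S [Rm [GE Rk]]]] := Mdiv G G0.
have : poly_at (lead_coef M ^+ m *: G)^`() = poly_at (S * M + Rm)^`() by rewrite GE.
rewrite derivZ -mul_polyC derivD derivM !rmorphD !rmorphM Mc.1 (killed' Rm Rk).
rewrite mulr0 add0r addr0; apply: contra_eq_neq => ->; rewrite mulr0.
rewrite mulf_neq0 //.
by rewrite poly_atC rmorphXn expf_neq0 ?Mc.2.
Qed.

End SimpleRoot.

(** * Separable relations over an algebraically closed field *)

Section PerfectRelation.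
Variables (k : closedFieldType) (n : nat).

Lemma pth_root_exists p (c : k) : prime p -> exists b, b ^+ p = c.
Proof.
move=> /prime_gt0 p0; have [|b] := closed_rootP ('X^p - c%:P : {poly k}) _.
  by rewrite size_XnsubC // eqSS -lt0n.
by rewrite /root !hornerE subr_eq0 => /eqP; exists b.
Qed.

Lemma msize_mderiv (i : 'I_n) (P : {mpoly k[n]}) :
  P != 0 -> (msize P^`M(i) < msize P)%N.
Proof.
move=> P0; rewrite [X in (X < _)%N]msizeE.
rewrite -[X in (_ < X)%N](@prednK (msize P)) ?ltnS; last first.
  by rewrite lt0n msize_poly_eq0.
apply/bigmax_leqP_seq => m; rewrite mcoeff_msupp mcoeff_mderiv => Pm _.
have : (m + U_(i))%MM \in msupp P.
  by rewrite mcoeff_msupp; apply: contraNneq Pm => ->; rewrite mul0rn.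
move=> /msize_mdeg_lt; rewrite mdegD mdeg1 addn1 => sP.
by rewrite -ltnS prednK // (leq_trans _ sP).
Qed.

Lemma mderiv_eq0_coef (P : {mpoly k[n]}) (i : 'I_n) m :
  P^`M(i) = 0 -> P@_m *+ m i = 0.
Proof.
move=> P0; case mi : (m i) => [|d]; first by rewrite mulr0n.
have := mcoeff_mderiv i P (m - U_(i))%MM.
have -> : (m - U_(i) + U_(i))%MM = m.
  by rewrite submK // lep1mP mi.
by rewrite P0 mcoeff0 mnmBE mnm1E eqxx mi subn1 /= => <-.
Qed.

(** A nonzero exponent of [P] must vanish in [k], so the characteristic is some p > 0 and divides
    all exponents. Additivity of Frobenius then assembles the root from p-th roots of the terms. *)
Lemma mderiv_eq0_pth_power (P : {mpoly k[n]}) :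
  (forall i, P^`M(i) = 0) -> (1 < msize P)%N ->
  exists p (G : {mpoly k[n]}), prime p /\ P = G ^+ p.
Proof.
move=> dP sP.
have [m0 [i0 [Pm0 m0i]]] : exists m i, P@_m != 0 /\ m i != 0%N.
  apply: contrapT => nex.
  have : (msize P <= 1)%N.
    rewrite msizeE; apply/bigmax_leqP_seq => m; rewrite mcoeff_msupp => Pm _.
    rewrite ltnS leqn0 mdeg_eq0; apply/eqP/mnmP => i; rewrite mnm0E.
    by apply: contrapT => /eqP mi; apply: nex; exists m, i.
  by rewrite leqNgt sP.
have [p pk] : exists p, p \in [pchar k].
  apply: (@natf0_pchar k (m0 i0)); first by rewrite lt0n.
  have /eqP := mderiv_eq0_coef m0 (dP i0).
  by rewrite -[_ *+ _]mulr_natr mulf_eq0 (negPf Pm0).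
have pp : prime p by case/andP: pk.
have pm m : P@_m != 0 -> forall i, (p %| m i)%N.
  move=> Pm i; have /eqP := mderiv_eq0_coef m (dP i).
  by rewrite -[_ *+ _]mulr_natr mulf_eq0 (negPf Pm) /= -(dvdn_pcharf pk).
have [root rootE] := choice (fun c => pth_root_exists c pp).
have pkn : p \in [pchar {mpoly k[n]}].
  rewrite inE pp /= -mpolyC_nat; case/andP: pk => _ /eqP ->.
  by rewrite mpolyC0.
exists p, (\sum_(m <- msupp P) root P@_m *: 'X_[[multinom (m i %/ p)%N | i < n]]).
split=> //; rewrite -(pFrobenius_autE pkn) rmorph_sum [LHS]mpolyE.
apply: eq_big_seq => m; rewrite mcoeff_msupp => Pm.
rewrite /= pFrobenius_autE exprZn rootE mpolyXn; congr (_ *: 'X_[_]).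
by apply/mnmP => i; rewrite mulmnE mnmE divnK // pm.
Qed.

(** For nonzero polynomials [msize] is the total degree plus one, hence the predecessors. *)
Lemma msize_expr (G : {mpoly k[n]}) e : G != 0 -> (msize (G ^+ e)).-1 = (e * (msize G).-1)%N.
Proof.
move=> G0; elim: e => [|e IHe].
  by rewrite expr0 mul0n -mpolyC1 msizeC oner_eq0.
have Ge0 : G ^+ e != 0 by rewrite expf_neq0.
have : (0 < msize G)%N by rewrite lt0n msize_poly_eq0.
have : (0 < msize (G ^+ e))%N by rewrite lt0n msize_poly_eq0.
rewrite exprS msizeM // mulSn -IHe.
by case: (msize (G ^+ e)) => // a; case: (msize G) => // b _ _; rewrite addSn addnS.
Qed.

(* Among the nonzero relations take one of least degree: if all its partial
   derivatives vanished at [x] they would vanish identically, and the relation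
   would be a [p]-th power, [k] being perfect. *)
Lemma separable_relation (F : idomainType) (j : {rmorphism k -> F}) (x : 'I_n -> F)
    (P : {mpoly k[n]}) :
  P != 0 -> mmap j x P = 0 ->
  exists i Q, mmap j x Q = 0 /\ mmap j x Q^`M(i) != 0.
Proof.
have [N] := ubnP (msize P); elim: N P => // N IHN P; rewrite ltnS => sP P0 Px.
apply: contrapT => nex.
have dx i : mmap j x P^`M(i) = 0.
  by apply: contrapT => /eqP Pi; apply: nex; exists i, P.
have dP i : P^`M(i) = 0.
  apply: contrapT => /eqP dPi0; apply: nex; apply: IHN dPi0 (dx i).
  by apply: leq_trans sP; exact: msize_mderiv.
have sP1 : (1 < msize P)%N.
  rewrite ltnNge; apply: contra_neqN P0 => sP1.
  have [c Pc] : exists c, P = c%:MP.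
    have [s0|] := posnP (msize P).
      by exists 0; apply/eqP; rewrite mpolyC0 -msize_poly_eq0 s0.
    move=> sgt; have /msize_poly1P[c _ ->] : msize P == 1%N by rewrite eqn_leq sP1.
    by exists c.
  by move/eqP: Px; rewrite Pc mmapC fmorph_eq0 => /eqP ->; rewrite mpolyC0.
have [p [G [pp PG]]] := mderiv_eq0_pth_power dP sP1.
have G0 : G != 0.
  by apply: contraNneq P0 => G0; rewrite PG G0 expr0n -[p]prednK ?prime_gt0.
have Gx : mmap j x G = 0.
  by move/eqP: Px; rewrite PG rmorphXn expf_eq0 => /andP[_ /eqP].
apply: nex; apply: (IHN G) => //; apply: leq_trans sP.
have := msize_expr p G0; rewrite -PG.
have : (0 < msize G)%N by rewrite lt0n msize_poly_eq0.
case: (msize G) => // s _; case: (msize P) sP1 => // t; rewrite ltnS => t0 /= tE.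
rewrite ltnS tE ltn_Pmull ?prime_gt1 //.
by move: t0; rewrite tE muln_gt0 => /andP[].
Qed.

End PerfectRelation.

(** * Multivariate polynomials as univariate ones in a chosen variable *)

Section SplitVariable.
Variables (k : comNzRingType) (n : nat) (i : 'I_n.+1).
Local Notation T := {mpoly k[n]}.

Definition isolate_var : {rmorphism {mpoly k[n.+1]} -> {poly T}} :=
  mmap (polyC \o @mpolyC n k)
    (fun j => if unlift i j is Some j' then ('X_j')%:P else 'X).

Definition merge_var : {rmorphism {poly T} -> {mpoly k[n.+1]}} :=
  poly_at (mmap (@mpolyC n.+1 k) (fun j : 'I_n => 'X_(lift i j))) 'X_i.

Lemma isolate_varC c : isolate_var c%:MP = c%:MP%:P.
Proof. exact: mmapC. Qed.

Lemma isolate_varX : isolate_var 'X_i = 'X.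
Proof. by rewrite [LHS]mmapXi unlift_none. Qed.

Lemma isolate_var_lift j : isolate_var 'X_(lift i j) = ('X_j)%:P.
Proof. by rewrite [LHS]mmapXi liftK. Qed.

Lemma isolate_var_mderiv P : isolate_var P^`M(i) = (isolate_var P)^`().
Proof.
elim/mpoly_ring_ind: P => [c|j|p q IHp IHq|p q IHp IHq].
- by rewrite mderivC rmorph0 isolate_varC derivC.
- rewrite mderivX mnm1E; case: (unliftP i j) => [j'|] ->.
    by rewrite isolate_var_lift derivC eq_sym (negPf (neq_lift _ _)) scale0r rmorph0.
  by rewrite isolate_varX derivX eqxx scale1r -{1}[U_(i)%MM]add0m addmK mpolyX0 rmorph1.
- by rewrite mderivD !rmorphD IHp IHq derivD.
- by rewrite mderivM !rmorphD !rmorphM IHp IHq derivM.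
Qed.

Variables (E : comNzRingType) (g : {rmorphism k -> E}) (y : 'I_n.+1 -> E).

Lemma poly_at_isolate_var P :
  poly_at (mmap g (y \o lift i)) (y i) (isolate_var P) = mmap g y P.
Proof.
apply: (mpoly_hom_ext (f := poly_at _ _ \o isolate_var) (g := mmap g y)) => [c|j].
  by rewrite -[LHS]/(poly_at _ _ (isolate_var _)) isolate_varC poly_atC /= !mmapC.
rewrite -[LHS]/(poly_at _ _ (isolate_var _)) [RHS]mmapXi.
case: (unliftP i j) => [j'|] ->; last by rewrite isolate_varX poly_atX.
by rewrite isolate_var_lift poly_atC /= mmapXi.
Qed.

Lemma mmap_merge_var Q :
  mmap g y (merge_var Q) = poly_at (mmap g (y \o lift i)) (y i) Q.
Proof.
rewrite /merge_var /poly_at /= /horner_eval -horner_map /= mmapXi -map_poly_comp.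
congr (_.[_]); apply: eq_map_poly.
apply: (mpoly_hom_ext (f := mmap g y \o mmap (@mpolyC n.+1 k) _)) => [c|j] /=.
  by rewrite !mmapC.
by rewrite !mmapXi.
Qed.

End SplitVariable.

Arguments isolate_var {k n}.
Arguments merge_var {k n}.

(* Says that [k -> k[x]_f] is formally smooth: a morphism out of [k[x]] is a tuple
   satisfying all polynomial relations of [x], and inverting [f] in [D] suffices
   because units lift along square-zero extensions. *)
Definition lifting_locus (k : comNzRingType) (F : comNzRingType)
    (j : {rmorphism k -> F}) n (x : 'I_n -> F) (f : {mpoly k[n]}) :=
  forall (C D : comNzRingType) (pi : {rmorphism C -> D}),
    (forall d, exists c, pi c = d) ->
    (forall c c', pi c = 0 -> pi c' = 0 -> c * c' = 0) ->
  forall (r : {rmorphism k -> C}) (d : 'I_n -> D),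
    (forall P, mmap j x P = 0 -> mmap (pi \o r) d P = 0) ->
    (exists v, v * mmap (pi \o r) d f = 1) ->
  exists c : 'I_n -> C, (forall i, pi (c i) = d i) /\
    (forall P, mmap j x P = 0 -> mmap r c P = 0).

Lemma mmap_comp n (k C D : comNzRingType) (pi : {rmorphism C -> D})
    (r : {rmorphism k -> C}) (c : 'I_n -> C) (d : 'I_n -> D) (P : {mpoly k[n]}) :
  (forall i, pi (c i) = d i) -> pi (mmap r c P) = mmap (pi \o r) d P.
Proof.
move=> cd; move: P.
apply: (mpoly_hom_ext (f := pi \o mmap r c) (g := mmap (pi \o r) d)) => [a|i] /=.
  by rewrite !mmapC.
by rewrite !mmapXi.
Qed.

Lemma poly_at_comp (T C D : comNzRingType) (pi : {rmorphism C -> D})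
    (e : {rmorphism T -> C}) (e' : {rmorphism T -> D}) a (Q : {poly T}) :
  (forall t, pi (e t) = e' t) -> pi (poly_at e a Q) = poly_at e' (pi a) Q.
Proof.
move=> ee'; rewrite /poly_at /= /horner_eval -horner_map -map_poly_comp.
by congr (_.[_]); apply: eq_map_poly.
Qed.

Lemma lifting_locus_free (k F : comNzRingType) (j : {rmorphism k -> F}) n
    (x : 'I_n -> F) :
  (forall P, mmap j x P = 0 -> P = 0) ->
  exists f, mmap j x f != 0 /\ lifting_locus j x f.
Proof.
move=> free; exists 1; rewrite rmorph1 oner_neq0; split=> // C D pi surj _ r d _ _.
have [c cd] := choice (fun i => surj (d i)); exists c; split=> // P /free ->.
exact: rmorph0.
Qed.

(** Induction on the number of generators: a separable relation makes some [x i] a simple root over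
    the others, and a lift of the others extends to it by Newton's method. *)
Lemma generic_lifting (k : closedFieldType) (F : idomainType)
    (j : {rmorphism k -> F}) n (x : 'I_n -> F) :
  exists f, mmap j x f != 0 /\ lifting_locus j x f.
Proof.
elim: n x => [|n IHn] x;
  have [free|/existsNP[P /not_implyP[Px /eqP P0]]] :=
    pselect (forall P, mmap j x P = 0 -> P = 0).
- exact: lifting_locus_free.
(* The variable of a separable relation would lie in the empty ['I_0]. *)
- by have [[]] := separable_relation P0 Px.
- exact: lifting_locus_free.
- have [i {P P0 Px} [P [Px dPx]]] := separable_relation P0 Px.
  pose x' := x \o lift i; have [f' [f'x f'lift]] := IHn x'.
  pose e : {rmorphism {mpoly k[n]} -> F} := mmap j x'.
  have Gx : poly_at e (x i) (isolate_var i P) = 0 by rewrite poly_at_isolate_var.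
  have G'x : poly_at e (x i) (isolate_var i P)^`() != 0.
    by rewrite -isolate_var_mderiv poly_at_isolate_var.
  have [M [[Mx lMx] M'x Mdiv]] := simple_root_generator Gx G'x.
  (* Inverting [f'] lifts the other generators, inverting the derivative permits the Newton step,
     and inverting the leading coefficient undoes pseudo-division. *)
  exists (merge_var i (f'%:P * (lead_coef M)%:P * M^`())).
  split; first by rewrite mmap_merge_var !rmorphM !poly_atC !mulf_neq0.
  move=> C D pi surj sq0 r d drel [v].
  pose d' := d \o lift i.
  have d'rel Q : mmap j x' Q = 0 -> mmap (pi \o r) d' Q = 0.
    move=> Qx; have := drel (merge_var i Q%:P).
    by rewrite !mmap_merge_var !poly_atC; apply.
  rewrite mmap_merge_var !rmorphM !poly_atC => vf.
  have [|c' [c'd c'rel]] := f'lift C D pi surj sq0 r d' d'rel.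
    exists (v * (mmap (pi \o r) d' (lead_coef M) *
      poly_at (mmap (pi \o r) d') (d i) M^`())).
    by rewrite -vf; ring.
  have [c0 c0d] := surj (d i).
  pose ec : {rmorphism {mpoly k[n]} -> C} := mmap r c'.
  have ecE (Q : {poly {mpoly k[n]}}) :
      pi (poly_at ec c0 Q) = poly_at (mmap (pi \o r) d') (d i) Q.
    by rewrite -c0d; apply: poly_at_comp => t; exact: mmap_comp.
  have Mc0 : pi (poly_at ec c0 M) = 0.
    by rewrite ecE -mmap_merge_var drel // mmap_merge_var.
  have [||ci [cid Mci]] := @sq0_newton _ _ pi surj sq0 (map_poly ec M) c0
     (v * (mmap (pi \o r) d' f' * mmap (pi \o r) d' (lead_coef M))).
  - exact: Mc0.
  - rewrite deriv_map -[_.[c0]]/(poly_at ec c0 _) ecE -vf; ring.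
  have [w wl] : exists w, w * ec (lead_coef M) = 1.
    apply: (sq0_lift_unit surj sq0
      (v := v * (mmap (pi \o r) d' f' * poly_at (mmap (pi \o r) d') (d i) M^`()))).
    by rewrite (mmap_comp _ _ c'd) -vf; ring.
  pose c j' := if unlift i j' is Some j'' then c' j'' else ci.
  have cl : c \o lift i = c' by apply/funext => j'; rewrite /c /= liftK.
  have ci' : c i = ci by rewrite /c unlift_none.
  exists c; split=> [j'|Q Qx].
    case: (unliftP i j') => [j''|] ->; last by rewrite ci' cid c0d.
    by rewrite -[c _]/((c \o lift i) _) cl c'd.
  (* After pseudo-division of the relation [Q] by [M], the remainder has relations of [x'] as
     coefficients, so both terms vanish at the lift. *)
  have [|m [S [Rm [QE Rk]]]] := Mdiv (isolate_var i Q).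
    by rewrite poly_at_isolate_var.
  rewrite -(poly_at_isolate_var i) cl ci'.
  have := congr1 (poly_at ec ci) QE.
  rewrite -mul_polyC rmorphD !rmorphM poly_atC rmorphXn.
  have -> : poly_at ec ci M = 0 by exact: Mci.
  have -> : poly_at ec ci Rm = 0 by apply: poly_at_eq0 => t; exact/c'rel/Rk.
  rewrite mulr0 addr0 => QE0.
  by rewrite -[LHS]mul1r -(expr1n _ m) -wl exprMn -mulrA QE0 mulr0.
Qed.

(** * The morphism to the additive group given by a slice *)

Section SpectrumTopology.

Lemma spec_ext (R : comNzRingType) (p q : spec R) :
  (forall a, spec_set p a <-> spec_set q a) -> p = q.
Proof.
case: p => P Pi Pp; case: q => Q Qi Qp /= PQ.
have {}PQ : P = Q by apply/funext => a; apply/propext.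
subst Q; by rewrite (Prop_irrelevance Pi Qi) (Prop_irrelevance Pp Qp).
Qed.

Lemma open_generization (R : comNzRingType) (U : set (spec R)) (p q : spec R) :
  open U -> spec_set p `<=` spec_set q -> U q -> U p.
Proof.
move=> [I ->] pq /= nIq; apply: contra_not nIq => Ip.
exact: subset_trans Ip pq.
Qed.

(** A nonempty relatively clopen part contains [p] by openness; a point outside it would put [p] in
    its open complement too. *)
Lemma connected_generization (R : comNzRingType) (A : set (spec R)) (p : spec R) :
  A p -> (forall q, A q -> spec_set p `<=` spec_set q) -> connected A.
Proof.
move=> Ap pA B [q Bq] [U Uo BU] [V Vc BV].
have Bp : B p.
  by move: Bq; rewrite BU => -[Aq Uq]; split=> //; exact: open_generization (pA _ Aq) Uq.
apply/seteqP; split=> r; first by rewrite BU => -[].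
move=> Ar; rewrite BV; split=> //; apply: contrapT => nVr.
have : (~` V) p by apply: open_generization (pA _ Ar) nVr; rewrite openC.
by move: Bp; rewrite BV => -[_ Vp]; apply.
Qed.

Lemma dense_generic_point (B : idomainType) (U : set (spec B)) :
  U (generic_point B) -> dense U.
Proof.
move=> Ug O [q Oq] Oo; exists (generic_point B); split=> //.
by apply: open_generization Oo _ Oq => b /= ->; exact: spec_set0.
Qed.

End SpectrumTopology.

Lemma const_notin_spec (k : fieldType) (p : spec {poly k}) c :
  c != 0 -> ~ spec_set p c%:P.
Proof.
move=> c0 pc; apply: (@spec_set1 _ p).
by rewrite -polyC1 -(mulVf c0) polyCM; exact: spec_setM.
Qed.

Section FiniteType.

Lemma finite_type_factor (R S T : comNzRingType) (f : {rmorphism R -> T})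
    (g : {rmorphism S -> T}) (e : {rmorphism R -> S}) :
  (forall a, g (e a) = f a) -> finite_type f -> finite_type g.
Proof.
move=> gef [n [x xsurj]]; exists n, x => y; have [p <-] := xsurj y.
exists (mmap (@mpolyC n S \o e) (fun i => 'X_i) p); move: p.
apply: (mpoly_hom_ext (f := mmap g x \o mmap (@mpolyC n S \o e) (fun i => 'X_i))
  (g := mmap f x)) => [c|i] /=.
  by rewrite !mmapC /= gef.
by rewrite !mmapXi.
Qed.

Lemma finite_type_loc (R : comNzRingType) (A : idomainType) (f : {rmorphism R -> A})
    (h : A) (h0 : h != 0) : finite_type f -> finite_type (loc_inj h \o f).
Proof.
move=> [n [x xsurj]].
pose x' i := if unlift ord_max i is Some j then loc_inj h (x j) else loc_h_inv h0.
exists n.+1, x' => y; have [[a m] /= ya] := loc_fracP y; have [p pa] := xsurj a.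
exists (merge_var ord_max (p%:P * 'X^m)).
rewrite mmap_merge_var rmorphM rmorphXn poly_atC poly_atX /=.
have -> : x' ord_max = loc_h_inv h0 by rewrite /x' unlift_none.
have x'x i : loc_inj h (x i) = (x' \o lift ord_max) i by rewrite /x' /= liftK.
by rewrite -(mmap_comp f p x'x) pa /= -ya -mulrA -exprMn loc_h_invP expr1n mulr1.
Qed.

End FiniteType.

Section SliceMorphism.
Variables (k : closedFieldType) (S : idomainType) (iota : {rmorphism k -> S}).
Hypothesis iota_ft : finite_type iota.
Variables (sigma : {rmorphism S -> {poly S}}) (sigmaP : is_coaction iota sigma).
Variables (s : S) (sP : is_slice sigma s).

Let Phi : {rmorphism {poly k} -> S} := poly_at iota s.

Let sigma_iota c : sigma (iota c) = (iota c)%:P.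
Proof. by case: sigmaP. Qed.

Lemma slice_morphism_equivariant : equivariant (@translation k) sigma Phi.
Proof.
move=> p; rewrite /Phi -[LHS]/(sigma (map_poly iota p).[s]) -horner_map sP.
rewrite -[RHS]/(map_poly _ (p^:P \Po _)) map_comp_poly.
have -> : map_poly (poly_at iota s) ('X + 'X%:P) = s%:P + 'X.
  by rewrite addrC rmorphD; congr (_ + _);
    [rewrite [LHS]map_polyC; congr (_%:P); exact: poly_atX | exact: map_polyX].
rewrite /comp_poly -!map_poly_comp; congr (_.[_]); apply: eq_map_poly => c.
by rewrite -[RHS]/(poly_at iota s c%:P)%:P poly_atC -sigma_iota.
Qed.

(** A slice is transcendental over the invariants: the coaction turns u(s) = 0 into u(s + t) = 0,
    and t is then replaced by t - s. *)
Lemma horner_slice_eq0 (u : {poly S}) :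
  (forall i, u`_i \in Ga_invariant sigma) -> u.[s] = 0 -> u = 0.
Proof.
move=> uinv us0; have : sigma u.[s] = 0 by rewrite us0 rmorph0.
rewrite -horner_map sP.
have -> : map_poly sigma u = u^:P.
  by apply/polyP => i; rewrite !coef_map /=; apply/eqP; exact: uinv.
rewrite -[_.[_]]/(u \Po _) => uc0.
have := congr1 (comp_poly ('X - s%:P)) uc0; rewrite -comp_polyA comp_poly0.
by rewrite comp_polyD comp_polyC comp_polyX addrC subrK comp_polyXr.
Qed.

Let iota_inv c : iota c \in Ga_invariant sigma.
Proof. by rewrite unfold_in sigma_iota. Qed.

Lemma slice_morphism_inj : injective Phi.
Proof.
apply: raddf_inj => p p0; apply: (map_inj_poly (fmorph_inj iota) (rmorph0 iota)).
rewrite map_poly0; apply: horner_slice_eq0 p0 => i.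
by rewrite coef_map iota_inv.
Qed.

Lemma slice_morphism_dominant : dominant Phi.
Proof.
apply: dense_generic_point; exists (generic_point S) => //.
apply: spec_ext => p /=; split=> [p0|->]; last exact: (rmorph0 Phi).
exact: slice_morphism_inj (etrans p0 (esym (rmorph0 Phi))).
Qed.

Lemma slice_sub_const c : is_slice sigma (s - iota c).
Proof. by rewrite /is_slice rmorphB sP sigma_iota polyCB addrAC. Qed.

(** The Dixmier map of [s - iota c] kills this slice and fixes constants, so it sends [s] to
    [iota c]. *)
Lemma dixmier_val_slice_morphism c p : dixmier_val sigma (s - iota c) (Phi p) = iota p.[c].
Proof.
rewrite -(horner_map iota) -[LHS]/((sigma (map_poly iota p).[s]).[- (s - iota c)]).
rewrite -horner_map sP -map_poly_comp.
rewrite (eq_map_poly (g := polyC \o iota)); last by move=> a; exact: sigma_iota.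
rewrite map_poly_comp -[_.[s%:P + 'X]]/(_ \Po _) horner_comp !hornerE.
by rewrite opprB addrC subrK.
Qed.

(** The fibre over the generic point contains the generic point of Spec S. Any other point is the
    ideal of some 'X - c, [k] being algebraically closed, and its fibre is the zero locus of
    [s - iota c], which is irreducible. *)
Lemma slice_morphism_fibre_connected y : connected (fibre Phi y).
Proof.
have [y0|/existsNP[f /not_implyP[yf /eqP f0]]] := pselect (forall p, spec_set y p -> p = 0).
  apply: (@connected_generization _ _ (generic_point S)).
    apply: spec_ext => p /=; split=> [p0|/y0 ->]; last exact: (rmorph0 Phi).
    by rewrite (slice_morphism_inj (etrans p0 (esym (rmorph0 Phi)))); exact: spec_set0.
  by move=> q _ a /= ->; exact: spec_set0.
have [c yc] : exists c, spec_set y ('X - c%:P).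
  have [r fr] := closed_field_poly_normal f.
  apply: contrapT => nc; move: yf; rewrite fr -mul_polyC => /spec_set_prime[yl|].
    by apply: (const_notin_spec _ yl); rewrite lead_coef_eq0.
  elim: r {fr} => [|c r IHr]; first by rewrite big_nil; exact: spec_set1.
  by rewrite big_cons => /spec_set_prime[yc|//]; apply: nc; exists c.
have ycE p : spec_set y p <-> p.[c] = 0.
  have /factor_theorem[q pq] : root (p - p.[c]%:P) c by rewrite /root !hornerE subrr.
  split=> [yp|pc0]; last first.
    by rewrite -(subr0 p) -polyC0 -pc0 pq; exact: spec_setM.
  apply: contrapT => /eqP pc0; apply: (const_notin_spec (p := y) pc0).
  have -> : p.[c]%:P = - 1 * (q * ('X - c%:P)) + p by rewrite -pq mulN1r opprB subrK.
  by apply: spec_setMD => //; exact: spec_setM.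
(* The kernel of the Dixmier map is the ideal of [s - iota c], here seen to be prime. *)
pose x0 := comap (dixmier_val sigma (s - iota c)) (generic_point S).
apply: (@connected_generization _ _ x0).
  apply: spec_ext => p; apply: iff_trans (iff_sym (ycE p)).
  rewrite -[spec_set _ _]/(dixmier_val sigma (s - iota c) (Phi p) = 0).
  rewrite dixmier_val_slice_morphism; split=> [/eqP|->]; last exact: rmorph0.
  by rewrite fmorph_eq0 => /eqP.
move=> q qy b b0.
have /(dixmier_eq0 sigmaP (slice_sub_const c))[a ->] :
    dixmier sigmaP (slice_sub_const c) b = 0 by exact: val_inj.
apply: spec_setM; have -> : s - iota c = Phi ('X - c%:P).
  by rewrite rmorphB /Phi poly_atX poly_atC.
by rewrite -[spec_set _ _]/(spec_set (comap Phi q) _) qy.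
Qed.

(** * Generic smoothness of the morphism given by a slice *)

Section GenericSmoothness.
Variables (n : nat) (x : 'I_n -> S).
Hypothesis x_inv : forall i, x i \in Ga_invariant sigma.
Hypothesis x_gen : forall b, b \in Ga_invariant sigma -> exists P, mmap iota x P = b.

Let ev : {rmorphism {mpoly k[n]} -> S} := mmap iota x.

Let ev_inv P : ev P \in Ga_invariant sigma.
Proof.
rewrite unfold_in; apply/eqP; move: P.
apply: (mpoly_hom_ext (f := sigma \o ev) (g := polyC \o ev)) => [c|i] /=.
  by rewrite /ev /= mmapC sigma_iota.
by rewrite /ev /= mmapXi; apply/eqP; exact: x_inv.
Qed.

Let pres : {rmorphism {poly {mpoly k[n]}} -> S} := poly_at ev s.

Let pres_surj b : exists Q, pres Q = b.
Proof.
have [T _ TK] := slice_trivialization_bij sigmaP sP.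
have [sec secE] := choice (fun r : Ga_invariants sigma => x_gen (inv_valP r)).
exists (\poly_(i < size (T b)) sec (T b)`_i); rewrite -[RHS]TK.
rewrite -[LHS]/((map_poly ev _).[s]) -[RHS]/((map_poly (inv_incl sigma) _).[s]).
congr (_.[s]); apply/polyP => i; rewrite !coef_map coef_poly.
case: ltnP => [_|sT]; first exact: secE.
rewrite [(T b)`_i]nth_default //.
exact: etrans (rmorph0 ev) (esym (rmorph0 (inv_incl sigma))).
Qed.

(** Because [s] is transcendental over the invariants, the relations of this presentation are,
    coefficientwise, the relations of [x]. *)
Let pres_eq0 Q : pres Q = 0 -> forall i, ev Q`_i = 0.
Proof.
move=> Q0 i; rewrite -(coef_map ev).
rewrite (horner_slice_eq0 _ Q0) ?coef0 // => {}i.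
by rewrite coef_map ev_inv.
Qed.

(** For formal smoothness, the hypothesis on [f] lifts the invariants [x], and compatibility with
    [r] dictates the image of [s]; the presentation makes this a morphism on [S], which extends to
    the localization. *)
Lemma slice_morphism_smooth_on f : ev f != 0 -> lifting_locus iota x f ->
  smooth (loc_inj (ev f) \o Phi).
Proof.
move=> f0 flift; split.
  apply: noetherian_finite_presentation; first exact/hilbert_basis/noetherian_field.
  apply: finite_type_loc => //; apply: finite_type_factor iota_ft.
  exact: (poly_atC iota s).
move=> C D pi surj sq0 r t comm.
pose r0 : {rmorphism k -> C} := r \o polyC.
pose d i := t (loc_inj (ev f) (x i)).
have dE P : mmap (pi \o r0) d P = t (loc_inj (ev f) (ev P)).
  move: P; apply: (mpoly_hom_ext (f := mmap (pi \o r0) d)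
    (g := t \o loc_inj (ev f) \o ev)) => [c|i].
    rewrite [LHS]mmapC -[LHS]/((pi \o r) c%:P) -comm -[LHS]/(t (loc_inj _ (Phi _))).
    by rewrite [Phi _]poly_atC -[RHS]/(t (loc_inj _ (ev _))) [ev c%:MP]mmapC.
  by rewrite [LHS]mmapXi -[RHS]/(t (loc_inj _ (ev _))) [ev 'X_i]mmapXi.
have [||c [cd crel]] := flift C D pi surj sq0 r0 d.
- by move=> P P0; rewrite dE [ev P]P0 !rmorph0.
- exists (t (loc_h_inv f0)).
  by rewrite dE -rmorphM mulrC loc_h_invP rmorph1.
pose lft : {rmorphism {poly {mpoly k[n]}} -> C} := poly_at (mmap r0 c) (r 'X).
have [|chi chiE] := rmorphism_factor (psi := lft) pres_surj.
  by move=> Q /pres_eq0 Q0; apply: poly_at_eq0 => i; exact/crel/Q0.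
have pi_chi b : pi (chi b) = t (loc_inj (ev f) b).
  have [Q <-] := pres_surj b; rewrite chiE.
  have cd' P : pi (mmap r0 c P) = mmap (pi \o r0) d P by exact: mmap_comp.
  rewrite [LHS](poly_at_comp _ _ cd').
  rewrite [RHS](poly_at_comp (pi := t \o loc_inj (ev f)) s Q (fun P => esym (dE P))).
  congr (poly_at _ _ Q); apply: etrans (esym (comm 'X)) _.
  by have /= -> := poly_atX iota s.
(* The image of [ev f] is a unit in [D], and units lift along square-zero extensions. *)
have [w wf] : exists w, w * chi (ev f) = 1.
  apply: (sq0_lift_unit surj sq0 (v := t (loc_h_inv f0))).
  by rewrite pi_chi -rmorphM mulrC loc_h_invP rmorph1.
have fw : chi (ev f) * w = 1 by rewrite mulrC.
have liftE b : loc_lift fw (loc_inj (ev f) b) = chi b.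
  by rewrite (@loc_liftE _ _ _ _ _ _ _ b 0%N) expr0 mulr1.
exists (loc_lift fw); split.
  apply: (loc_hom_ext f0 (f := pi \o loc_lift fw)) => b /=.
  by rewrite liftE pi_chi.
move=> p; rewrite -[LHS]/(loc_lift fw (loc_inj (ev f) (Phi p))) liftE.
have -> : Phi p = pres (map_poly (@mpolyC n k) p).
  rewrite /Phi /pres /poly_at /= -map_poly_comp; congr (horner_eval s _).
  by apply: eq_map_poly => a /=; rewrite /ev /= mmapC.
rewrite chiE /lft /poly_at /= -map_poly_comp /horner_eval.
rewrite (eq_map_poly (g := r \o polyC)); last by move=> a /=; rewrite mmapC.
by rewrite map_poly_comp horner_map; congr (r _); exact: comp_polyXr.
Qed.

End GenericSmoothness.

Lemma slice_morphism_generically_smooth : generically_smooth Phi.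
Proof.
have [n [y ysurj]] := iota_ft.
(* The Dixmier map retracts [S] onto the invariants, so it carries generators of [S] to generators
   of the invariants. *)
pose x i := dixmier_val sigma s (y i).
have xinv i : x i \in Ga_invariant sigma by exact: (dixmier_inv sigmaP sP (y i)).
have xgen b : b \in Ga_invariant sigma -> exists P, mmap iota x P = b.
  move=> binv; have [P Pb] := ysurj b; exists P.
  have <- : dixmier_val sigma s b = b.
    by move: binv; rewrite unfold_in /= => /eqP ->; rewrite /horner_eval hornerC.
  rewrite -Pb; move: {Pb} P.
  apply: (mpoly_hom_ext (f := mmap iota x)
    (g := dixmier_val sigma s \o mmap iota y)) => [c|i] /=.
    by rewrite !mmapC /= sigma_iota /horner_eval hornerC.
  by rewrite !mmapXi.
have [f [f0 flift]] := generic_lifting iota x.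
exists [set q | ~ spec_set q (mmap iota x f)]; split.
- exists [set mmap iota x f]; apply/seteqP; split=> q /= qf.
    by move=> sub; apply: qf; exact: sub.
  by apply: contra_not qf => qf _ ->.
- by apply: dense_generic_point => /=; exact/eqP.
- by move=> q qf; exists (mmap iota x f) => //; exact: slice_morphism_smooth_on.
Qed.

End SliceMorphism.

(** * The equivalences *)

(** The retraction is [q] followed by the inverse of [q \o incl]; factoring the identity through
    this bijection makes the inverse a ring morphism. *)
Lemma bijective_retraction (R S : comNzRingType) (Q : comPzRingType)
    (incl : {rmorphism R -> S}) (q : {rmorphism S -> Q}) :
  bijective (q \o incl) -> exists pi : {rmorphism S -> R},
    (forall r, pi (incl r) = r) /\ (forall b, pi b = 0 <-> q b = 0).
Proof.
case=> f fK Kf.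
have [||chi chiE] := rmorphism_factor (phi := q \o incl) (psi := idfun).
- by move=> y; exists (f y); exact: Kf.
- by move=> r r0; rewrite -[LHS]fK r0 -(fK 0) /= !rmorph0.
exists (chi \o q); split=> [r|b] /=; first exact: chiE.
split=> [b0|->]; last exact: rmorph0.
have qb : q (incl (f (q b))) = q b := Kf (q b).
have fqb : 0 = f (q b) by have := chiE (f (q b)); rewrite /= qb b0.
by rewrite -qb -fqb !rmorph0.
Qed.

Lemma right_inverse_unique (R : comNzRingType) (l x y : R) :
  l * x = 1 -> l * y = 1 -> x = y.
Proof. by move=> lx ly; rewrite -[x]mulr1 -ly mulrCA mulrA lx mul1r. Qed.

Lemma map_poly_linear (R S : comNzRingType) (f : {rmorphism R -> S}) a b :
  map_poly f (a%:P + b *: 'X) = (f a)%:P + f b *: 'X.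
Proof. by rewrite rmorphD /= map_polyC map_polyZ map_polyX. Qed.

Section PrinciplePairs.
Variables (A : idomainType) (beta : {rmorphism A -> {poly A}}).
Variables (h : A) (h0 : h != 0) (hinv : h \in Ga_invariant beta).

(** Clearing the denominator of s = g / h^e multiplies s + t by the invariant h^e. *)
Lemma slice_principle_pair (s : loc h) :
  is_slice (loc_coaction h0 hinv) s -> exists g e, principle_pair beta g (h ^+ e).
Proof.
move=> sP; have [[g e] /= sg] := loc_fracP s; exists g, e; split; first exact: rpredX.
apply: (map_inj_poly (@loc_inj_injective A h) (rmorph0 (loc_inj h))).
rewrite -loc_coactionE -sg rmorphM rmorphXn sP loc_coactionE.
have /eqP -> : beta h == h%:P by [].
rewrite map_polyC map_poly_linear /= -sg rmorphXn polyCM polyC_exp mulrDl; congr (_ + _).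
by rewrite -mul_polyC polyC_exp mulrC.
Qed.

Lemma principle_pair_slice g e : principle_pair beta g (h ^+ e) ->
  is_slice (loc_coaction h0 hinv) (loc_inj h g * loc_h_inv h0 ^+ e).
Proof.
case=> _ gP; rewrite /is_slice.
(* The coaction fixes [h], hence also its inverse. *)
have hV : loc_coaction h0 hinv (loc_h_inv h0) = (loc_h_inv h0)%:P.
  have hh : (loc_inj h h)%:P * loc_coaction h0 hinv (loc_h_inv h0) = 1.
    have /eqP hE : beta h == h%:P by [].
    by rewrite -(map_polyC (loc_inj h)) -hE -loc_coactionE -rmorphM loc_h_invP rmorph1.
  apply: right_inverse_unique hh _.
  by rewrite -polyCM loc_h_invP.
rewrite rmorphM rmorphXn hV loc_coactionE gP map_poly_linear rmorphXn.
rewrite mulrDl -polyC_exp -polyCM; congr (_ + _).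
by rewrite -mul_polyC mulrAC -polyCM -exprMn loc_h_invP expr1n mul1r.
Qed.

End PrinciplePairs.

Theorem proposition3p5 (k : closedFieldType) (A : idomainType)
  (iota : {rmorphism k -> A}) (Aft : finite_type iota)
  (beta : {rmorphism A -> {poly A}}) (betaP : is_coaction iota beta)
  (h : A) (h0 : h != 0) (hinv : h \in Ga_invariant beta) :
  let Ah := loc h in
  let beta_h : {rmorphism Ah -> {poly Ah}} := loc_coaction h0 hinv in
  [<->
    (* (a) *)
    trivial_Ga_bundle beta_h;
    (* (b) *)
    exists Phi : {rmorphism {poly k} -> Ah},
      [/\ forall c, Phi c%:P = loc_inj h (iota c),
          equivariant (@translation k) beta_h Phi,
          dominant Phi,
          generically_smooth Phi &
          forall y : spec {poly k}, connected (fibre Phi y)];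
    (* (c) *)
    exists (g : A) (e : nat), principle_pair beta g (h ^+ e);
    (* (d) *)
    exists g : A,
      (forall x : spec Ah, spec_set x (loc_inj h g) ->
         trivial_stabilizer beta_h x) /\
      (exists (Q : comPzRingType) (q : {rmorphism Ah -> Q}),
         closed_subscheme (loc_inj h g) q /\
         bijective (q \o inv_incl beta_h))
  ].
Proof.
move=> Ah beta_h; pose iota_h : {rmorphism k -> Ah} := loc_inj h \o iota.
have betahP : is_coaction iota_h beta_h by exact: loc_coaction_is_coaction.
tfae.
- case/trivial_slice => s sP; exists (poly_at iota_h s); split.
  + exact: poly_atC.
  + exact: slice_morphism_equivariant.
  + exact: (slice_morphism_dominant betahP sP).
  + by apply: (slice_morphism_generically_smooth _ betahP sP); exact: finite_type_loc.
  + exact: (slice_morphism_fibre_connected betahP sP).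
- case=> Phi [_ /equivariant_slice sP _ _ _].
  exact: slice_principle_pair sP.
- case=> g [e /(principle_pair_slice h0 hinv) sP]; exists g; split.
    by move=> x _; exact: (slice_stabilizer betahP sP).
  (* The ring of invariants itself is the co-ordinate ring of V(g), through the Dixmier map. *)
  exists (Ga_invariants beta_h), (dixmier betahP sP); split; last first.
    by exists id => r /=; exact: dixmier_incl.
  split=> [r|b]; first by exists (inv_incl beta_h r); exact: dixmier_incl.
  (* The slice and [g] differ by a power of the unit [h], so they generate the same ideal. *)
  apply: iff_trans (dixmier_eq0 betahP sP b) _; split=> -[c ->].
    by exists (c * loc_h_inv h0 ^+ e); rewrite mulrAC mulrA.
  exists (c * loc_inj h h ^+ e).
  by rewrite mulrACA -exprMn loc_h_invP expr1n mulr1.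
- case=> g [stab [Q [q [[_ q_eq0] /bijective_retraction[pi [pi_incl pi_eq0]]]]]].
  have [s sP] : exists s, is_slice beta_h s.
    apply: (stabilizer_slice betahP pi_incl _ stab) => b.
    exact: iff_trans (pi_eq0 b) (q_eq0 b).
  exact: (slice_trivial betahP sP).
Qed.
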